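(* Let $A$ be an $m$-Koszul Artin--Schelter regular algebra, generated in degree $1$, of Gorenstein parameter $\ell$ and of global dimension and GK dimension $d$, and suppose that $A$ is GK-Cohen--Macaulay. Let $H$ be a semisimple Hopf algebra such that $A$ is a left $H$-module algebra, each $A_i$ is an $H$-submodule of $A$, and the action is inner-faithful. Let $\Lambda=e(A\# H)e$ be the quiver algebra Morita equivalent to $A\# H$ described in the context, with $e_0$ the idempotent at the vertex $0$ corresponding to the trivial representation. Then the Auslander map $$\gamma:A\# H\to\operatorname{End}(A_{A^H}),\qquad \gamma(a\# h)(b)=a(h\cdot b),$$ is an isomorphism if and only if $\operatorname{GKdim}\Lambda/\langle e_0\rangle\leqslant\operatorname{GKdim}A-2$.
   Context: $\Bbbk$ is an algebraically closed field of characteristic $0$; unadorned tensor products are over $\Bbbk$; $\Delta(h)=h_{(1)}\otimes h_{(2)}$, $\varepsilon$, $S$ denote coproduct, counit, antipode. Semisimple Hopf algebras are finite-dimensional with $S^2=\mathrm{id}$. $\operatorname{GKdim}$ is the usual Gelfand--Kirillov dimension; for finitely generated graded modules/algebras as occurring here it is $\limsup_{n}\log_n\big(\sum_{i\le n}\dim_\Bbbk M_i\big)$. AS regular: a connected graded $\Bbbk$-algebra $A$ ($\mathbb{N}$-graded, $A_0=\Bbbk$) is AS regular of dimension $d$ with Gorenstein parameter $\ell$ if its left and right injective dimensions equal $d<\infty$; $\operatorname{Ext}^i_A({}_A\Bbbk,{}_AA)$ is $0$ for $i\ne d$ and is $\Bbbk[\ell]$ ($M[\ell]_n=M_{\ell+n}$)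 for $i=d$, and symmetrically on the right with the same $\ell$; $A$ has global dimension $d$ and finite GK dimension. $m$-Koszul: $A=T_\Bbbk(V)/\langle\mathcal R\rangle$ with $V=A_1$ finite-dimensional, $\mathcal R\subseteq V^{\otimes m}$, and the $m$-Koszul complex of $A$ is exact; equivalently $\operatorname{Tor}_i^A(\Bbbk,\Bbbk)$ is concentrated in degree $\rho(i)$ for all $i$, where $\rho(i)=mi/2$ ($i$ even), $m(i-1)/2+1$ ($i$ odd). GK-Cohen--Macaulay: $j(M)+\operatorname{GKdim}M=\operatorname{GKdim}A$ for every nonzero finitely generated $A$-module $M$, where $j(M)=\min\{i\mid\operatorname{Ext}^i_A(M,A)\neq0\}$. Hopf actions: $A$ is a left $H$-module algebra if $h\cdot(ab)=(h_{(1)}\cdot a)(h_{(2)}\cdot b)$ and $h\cdot 1=\varepsilon(h)1$; $A^H=\{a\mid h\cdot a=\varepsilon(h)a\ \forall h\in H\}$; $A\# H$ is $A\otimes H$ with $(a\# h)(b\# k)=a(h_{(1)}\cdot b)\# h_{(2)}k$, graded with $H$ in degree $0$. Inner-faithful: $IA\ne0$ for every nonzero Hopf ideal $I$ of $H$. The homological determinant is $\operatorname{hdet}_A=\eta\circ S$, where $\eta:H\to\Bbbk$ is the character by which $H$ acts on the one-dimensional module $\operatorname{Ext}^d_A(\Bbbk,\Bbbk)$ (computed with a graded $A\# H$-projective resolution of $\Bbbk$), and $\Xi(h)=\operatorname{hdet}_A(h_{(1)})h_{(2)}$. The algebra $\Lambda$: let $V_0,\dots,V_n$ be the irreducible $H$-modules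 up to isomorphism, $V_0$ trivial. Choose pairwise orthogonal idempotents $e_0,\dots,e_n\in H$ with $He_i\cong V_i$ and $\{e_0,\dots,e_n\}$ closed under the automorphism $\Xi$ (such a choice exists). Put $e=\sum e_i$, a full idempotent of $H$ and of $A\# H$, and $\Lambda=e(A\# H)e$, which is Morita equivalent to $A\# H$. It is a quotient of the path algebra of the left McKay quiver of $V=A_1$ (vertices $0,\dots,n$; $\dim\operatorname{Hom}_H(V_i,V\otimes V_j)$ arrows $i\to j$), the $e_i$ being the vertex idempotents. *)

(* Defs.v *)
(* monalg is imported without its notations, which clash with those of
   MathComp-Analysis. *)
From HB Require Import structures.
From mathcomp Require Import all_boot all_order all_algebra all_field.
From mathcomp Require Import all_classical all_reals all_analysis.
From mathcomp Require Import -(notations) monalg.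
From mathcomp Require Import ring.

Set Implicit Arguments.
Unset Strict Implicit.
Unset Printing Implicit Defensive.

Import Order.TTheory GRing.Theory Num.Theory.
Local Open Scope classical_set_scope.
Local Open Scope ring_scope.

(* Right B-modules are left modules over the converse ring B^c, which MathComp
   does not equip with its algebra structure. *)
Section ConverseAlgebra.
Variables (K : comNzRingType) (B : algType K).

HB.instance Definition _ := GRing.Lmodule.copy B^c B.

Fact converse_scalerAl (c : K) (x y : B^c) : c *: (x * y) = (c *: x : B^c) * y.
Proof. exact: (@scalerAr K B c y x). Qed.
HB.instance Definition _ :=
  GRing.LSemiModule_isLSemiAlgebra.Build K B^c converse_scalerAl.

Fact converse_scalerAr (c : K) (x y : B^c) : c *: (x * y) = x * (c *: y : B^c).
Proof. exact: (@scalerAl K B c y x). Qed.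
HB.instance Definition _ :=
  GRing.LSemiAlgebra_isSemiAlgebra.Build K B^c converse_scalerAr.

End ConverseAlgebra.

Section ConverseMorphism.
Variables (K : comNzRingType) (B : nzRingType) (f : {rmorphism B -> K}).

Definition converse_morph (x : B^c) : K := f x.

Fact converse_morph_is_nmod : nmod_morphism converse_morph.
Proof. by split; [exact: (rmorph0 f) | exact: (rmorphD f)]. Qed.
Fact converse_morph_is_monoid : monoid_morphism converse_morph.
Proof.
by split; [exact: (rmorph1 f) | move=> x y; rewrite mulrC; exact: (rmorphM f)].
Qed.
HB.instance Definition _ :=
  GRing.isNmodMorphism.Build B^c K converse_morph converse_morph_is_nmod.
HB.instance Definition _ :=
  GRing.isMonoidMorphism.Build B^c K converse_morph converse_morph_is_monoid.

End ConverseMorphism.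

Section Subspaces.
Variables (K : fieldType) (V : lmodType K).

Definition subspace (W : set V) : Prop :=
  W 0 /\ forall (c : K) u v, W u -> W v -> W (c *: u + v).

(* D is a grading of the abelian group underlying V. *)
Definition direct_sum_of (I : choiceType) (U : zmodType) (D : I -> set U) : Prop :=
  [/\ forall i, D i 0 /\ (forall u v, D i u -> D i v -> D i (u - v)),
      forall u, exists (s : seq I) (f : I -> U),
        (forall i, D i (f i)) /\ u = \sum_(i <- s) f i &
      forall (s : seq I) (f : I -> U), uniq s -> (forall i, D i (f i)) ->
        \sum_(i <- s) f i = 0 -> forall i, i \in s -> f i = 0].

Definition free_mod (I : set V) (s : seq V) : Prop :=
  forall c : nat -> K, I (\sum_(i < size s) c i *: s`_i) ->
  forall i, (i < size s)%N -> c i = 0.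

(* The dimension of the image in V / I of the span of S, for I a subspace. *)
Definition dim_mod (R : realType) (I S : set V) : \bar R :=
  ereal_sup [set ((size s)%:R)%:E |
             s in [set s : seq V | (forall v, v \in s -> S v) /\ free_mod I s]].

End Subspaces.

Section GKdimension.
Variables (R : realType) (K : fieldType).

(* lne 0 = -oo, so that the zero algebra has Gelfand-Kirillov dimension -oo. *)
Definition elog (n : nat) (x : \bar R) : \bar R :=
  (lne x * ((ln (n%:R : R))^-1)%:E)%E.

Definition growth_rate (f : nat -> \bar R) : \bar R :=
  limn_esup (fun n => elog n (f n)).

(* For C a subspace of B closed under products and I an ideal of C, the
   Gelfand-Kirillov dimension of the algebra C / I, whose finite-dimensional
   subspaces are the images of the spans of finite lists g of elements of C. *)
Definition GKdim_subquotient (B : algType K) (C I : set B) : \bar R :=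
  ereal_sup [set growth_rate (fun n => dim_mod R I
      [set x : B | exists w : seq B,
         [/\ (0 < size w <= n)%N, {subset w <= g} & x = \prod_(y <- w) y]])
    | g in [set g : seq B | forall y, y \in g -> C y]].

Definition GKdim (B : algType K) : \bar R := GKdim_subquotient [set: B] [set 0].

(* The K-space underlying a B-module. *)
Definition restrict_scalars (B : algType K) (M : lmodType B) : Type := M.

Section RestrictScalars.
Variables (B : algType K) (M : lmodType B).
Local Notation M' := (restrict_scalars M).
HB.instance Definition _ := GRing.Zmodule.on M'.

Let sc (c : K) (x : M') : M' := (c%:A : B) *: (x : M).

Fact restrict_scA a b x : sc a (sc b x) = sc (a * b) x.
Proof. by rewrite /sc scalerA -scalerAl mul1r scalerA. Qed.
Fact restrict_sc1 : left_id 1 sc.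
Proof. by move=> x; rewrite /sc scale1r (@scale1r B M). Qed.
Fact restrict_scDr : right_distributive sc +%R.
Proof. by move=> a x y; exact: (@scalerDr B M). Qed.
Fact restrict_scDl x : {morph sc^~ x : a b / a + b}.
Proof. by move=> a b; rewrite /sc scalerDl (@scalerDl B M). Qed.
HB.instance Definition _ := GRing.Zmodule_isLmodule.Build K M'
  restrict_scA restrict_sc1 restrict_scDr restrict_scDl.
End RestrictScalars.

Definition GKdim_module (B : algType K) (M : lmodType B) : \bar R :=
  ereal_sup [set growth_rate (fun n => @dim_mod K (restrict_scalars M) R [set 0]
      [set x | exists (w : seq B) (m : M),
         [/\ (size w <= n)%N, {subset w <= gm.1}, m \in gm.2
           & x = (\prod_(y <- w) y) *: m]])
    | gm in [set: seq B * seq M]].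

End GKdimension.

Section HomologicalAlgebra.
Variable B : nzRingType.

Definition projective_module (P : lmodType B) : Prop :=
  forall (X Y : lmodType B) (p : {linear X -> Y}) (f : {linear P -> Y}),
    (forall y, exists x, p x = y) ->
    exists g : {linear P -> X}, forall z, p (g z) = f z.

Definition injective_module (E : lmodType B) : Prop :=
  forall (X Y : lmodType B) (i : {linear X -> Y}) (f : {linear X -> E}),
    injective i -> exists g : {linear Y -> E}, forall x, g (i x) = f x.

Record proj_resolution (M : lmodType B) := ProjResolution {
  res_obj :> nat -> lmodType B;
  res_d : forall n, {linear res_obj n.+1 -> res_obj n};
  res_eps : {linear res_obj 0%N -> M};
  res_projective : forall n, projective_module (res_obj n);
  res_eps_surj : forall x, exists y, res_eps y = x;
  res_exact0 : forall x, res_eps x = 0 <-> exists y, res_d 0%N y = x;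
  res_exactS : forall n x, res_d n x = 0 <-> exists y, res_d n.+1 y = x }.

Record inj_resolution (M : lmodType B) := InjResolution {
  cores_obj :> nat -> lmodType B;
  cores_d : forall n, {linear cores_obj n -> cores_obj n.+1};
  cores_eta : {linear M -> cores_obj 0%N};
  cores_injective : forall n, injective_module (cores_obj n);
  cores_eta_inj : injective cores_eta;
  cores_exact0 : forall x, cores_d 0%N x = 0 <-> exists y, cores_eta y = x;
  cores_exactS : forall n x, cores_d n.+1 x = 0 <-> exists y, cores_d n y = x }.

Definition projdim_le (M : lmodType B) (n : nat) : Prop :=
  exists P : proj_resolution M, forall k, (n < k)%N -> forall x : P k, x = 0.

Definition injdim_le (M : lmodType B) (n : nat) : Prop :=
  exists E : inj_resolution M, forall k, (n < k)%N -> forall x : E k, x = 0.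

Definition injdim_eq (M : lmodType B) (d : nat) : Prop :=
  injdim_le M d /\ forall n, injdim_le M n -> (d <= n)%N.

Definition gldim_eq (d : nat) : Prop :=
  (forall M, projdim_le M d) /\
  forall n, (forall M, projdim_le M n) -> (d <= n)%N.

(* Cochains are taken as plain functions satisfying Q, where Q i singles out the
   homomorphisms of interest from P i to N. *)
Definition coboundary (M : lmodType B) (P : proj_resolution M) (N : zmodType)
    (Q : forall i, (P i -> N) -> Prop) (i : nat) : (P i -> N) -> Prop :=
  match i return (P i -> N) -> Prop with
  | 0%N => fun f => forall x, f x = 0
  | k.+1 => fun f => exists2 g, Q k g & forall x, f x = g (res_d P k x)
  end.

Definition cocycle (M : lmodType B) (P : proj_resolution M) (N : zmodType)
    (Q : forall i, (P i -> N) -> Prop) (i : nat) (f : P i -> N) : Prop :=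
  Q i f /\ forall x, f (res_d P i x) = 0.

Definition Ext_zero (i : nat) (M N : lmodType B) : Prop :=
  exists P : proj_resolution M,
    let Q k (f : P k -> N) := linear f in
    forall f : P i -> N, cocycle Q f -> coboundary Q f.

Definition finitely_generated (M : lmodType B) : Prop :=
  exists s : seq M, forall x, exists c : nat -> B,
    x = \sum_(i < size s) c i *: s`_i.

End HomologicalAlgebra.

(* The field K as a B-module through a ring morphism B -> K. *)
Definition residue (K : fieldType) (B : nzRingType)
  (aug : {rmorphism B -> K}) : Type := K.

Section ResidueModule.
Variables (K : fieldType) (B : nzRingType) (aug : {rmorphism B -> K}).
HB.instance Definition _ := GRing.Zmodule.copy (residue aug) K.

Let sc (b : B) (x : residue aug) : residue aug := aug b * (x : K).

Fact residue_scA a b x : sc a (sc b x) = sc (a * b) x.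
Proof. by rewrite /sc rmorphM mulrA. Qed.
Fact residue_sc1 : left_id 1 sc.
Proof. by move=> x; rewrite /sc rmorph1 mul1r. Qed.
Fact residue_scDr : right_distributive sc +%R.
Proof. by move=> a x y; rewrite /sc mulrDr. Qed.
Fact residue_scDl x : {morph sc^~ x : a b / a + b}.
Proof. by move=> a b; rewrite /sc rmorphD mulrDl. Qed.
HB.instance Definition _ := GRing.Zmodule_isLmodule.Build B (residue aug)
  residue_scA residue_sc1 residue_scDr residue_scDl.
End ResidueModule.

(* An N-grading of A with A_0 = K; conn_aug is its unique augmentation. *)
Record connected_grading (K : fieldType) (A : algType K) := ConnectedGrading {
  conn_deg :> nat -> set A;
  conn_subspace : forall n, subspace (conn_deg n);
  conn_direct : direct_sum_of conn_deg;
  conn_mul : forall i j a b,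
    conn_deg i a -> conn_deg j b -> conn_deg (i + j)%N (a * b);
  conn_deg0 : forall a, conn_deg 0%N a <-> exists c : K, a = c%:A;
  conn_aug : {rmorphism A -> K};
  conn_aug_scalar : forall c : K, conn_aug c%:A = c;
  conn_aug_pos : forall n a, (0 < n)%N -> conn_deg n a -> conn_aug a = 0 }.

Section GradedHomologicalAlgebra.
Variables (K : fieldType) (B : algType K).
Variables (deg : nat -> set B) (aug : {rmorphism B -> K}).

Definition graded_module (M : lmodType B) (D : int -> set M) : Prop :=
  direct_sum_of D /\
  forall i j b x, deg i b -> D j x -> D (i%:Z + j) (b *: x).

(* A graded projective resolution of K, placed in degree 0.  A graded module is
   projective in the category of graded modules iff it is projective. *)
Record graded_resolution := GradedResolution {
  gres :> proj_resolution (residue aug);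
  gres_deg : forall n, int -> set (gres n);
  gres_graded : forall n, graded_module (@gres_deg n);
  gres_d_deg : forall n i x, @gres_deg n.+1 i x -> @gres_deg n i (res_d gres n x);
  gres_eps_deg : forall i x, i != 0 -> @gres_deg 0%N i x -> res_eps gres x = 0 }.

Definition deg_int (n : int) : set B :=
  match n with Posz k => deg k | Negz _ => [set 0] end.

(* The B-linear maps P_k -> B raising degrees by n: they are the cochains which
   compute the degree n part of Ext_B(K, B). *)
Definition hom_deg (P : graded_resolution) (n : int) (k : nat)
    (f : P k -> B^o) : Prop :=
  linear f /\ forall j x, @gres_deg P k j x -> deg_int (j + n) (f x).

(* Ext^i_B(K, B) is zero for i <> d and is K[ell], one-dimensional and
   concentrated in degree - ell, for i = d. *)
Definition gorenstein (d : nat) (ell : int) : Prop :=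
  exists P : graded_resolution,
    (forall i n (f : P i -> B^o), i != d \/ n != - ell ->
       cocycle (@hom_deg P n) f -> coboundary (@hom_deg P n) f) /\
    exists f0 : P d -> B^o,
      [/\ cocycle (@hom_deg P (- ell)) f0,
          ~ coboundary (@hom_deg P (- ell)) f0 &
          forall f : P d -> B^o, cocycle (@hom_deg P (- ell)) f ->
            exists c : K,
              coboundary (@hom_deg P (- ell)) (fun x => f x - c *: f0 x)].

End GradedHomologicalAlgebra.

Definition AS_regular (R : realType) (K : fieldType) (A : algType K)
    (G : connected_grading A) (d : nat) (ell : int) : Prop :=
  [/\ injdim_eq (A^o : lmodType A) d /\ injdim_eq (A^c^o : lmodType A^c) d,
      gorenstein G (conn_aug G) d ell /\
      @gorenstein K A^c G (converse_morph (conn_aug G)) d ell,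
      gldim_eq A d /\ gldim_eq A^c d &
      (GKdim R A < +oo)%E].

(* The condition is imposed on left and on right modules. *)
Definition GK_CohenMacaulay (R : realType) (K : fieldType) (A : algType K) : Prop :=
  let CM (B : algType K) := forall M : lmodType B,
    finitely_generated M -> (exists x : M, x != 0) ->
    exists j : nat,
      [/\ ~ Ext_zero j M B^o, forall i, (i < j)%N -> Ext_zero i M B^o &
          ((j%:R)%:E + GKdim_module R M = GKdim R B)%E] in
  CM A /\ CM A^c.

Section Ideals.
Variable B : nzRingType.

(* The ideal generated by S in the subring C of B; C may have its own unit. *)
Definition ideal_in (C S : set B) : set B :=
  [set x | exists s : seq (B * B * B),
     (forall y, y \in s -> [/\ C y.1.1, S y.1.2 & C y.2]) /\
     x = \sum_(y <- s) y.1.1 * y.1.2 * y.2].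

End Ideals.

Section Koszul.
Variables (K : fieldType) (A : algType K) (G : connected_grading A).
Variables (m g : nat) (x : 'I_g -> A).

(* For V with basis x_0, ..., x_{g-1}: words of length n index the induced basis
   of the n-th tensor power of V, and T(V) is the monoid algebra of words. *)
Local Notation word := (fmonom 'I_g).
Local Notation T := (malg word K).
Local Notation AT := (malg word A).
Local Notation mono w := (mkmalgU (w : word) 1 : T).

Definition tensor_power (n : nat) : set T :=
  [set t | forall w : word, mcoeff w t != 0 -> size w = n].

Definition is_basis_of_A1 : Prop :=
  [/\ forall i, G 1%N (x i),
      forall a, G 1%N a -> exists c : 'I_g -> K, a = \sum_i c i *: x i &
      forall c : 'I_g -> K, \sum_i c i *: x i = 0 -> forall i, c i = 0].

Variable Rel : set T.

Definition presented : Prop :=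
  exists pi : {lrmorphism T -> A},
    [/\ forall i, pi (mono (FMonom [:: i])) = x i,
        forall a, exists t, pi t = a &
        forall t, pi t = 0 <-> ideal_in [set: T] Rel t].

(* V^i (x) Rel (x) V^j *)
Definition VRV (i j : nat) : set T :=
  [set t | exists s : seq (word * T * word),
     (forall y, y \in s -> [/\ size y.1.1 = i, Rel y.1.2 & size y.2 = j]) /\
     t = \sum_(y <- s) mono y.1.1 * y.1.2 * mono y.2].

(* W_n is all of V^n when n < m. *)
Definition koszulW (n : nat) : set T :=
  [set t | tensor_power n t /\
     forall i j, (i + m + j)%N = n -> VRV i j t].

(* A (x) W_n inside A (x) T(V), whose elements are polynomials in words with
   coefficients in A. *)
Definition AkoszulW (n : nat) : set AT :=
  [set t | exists s : seq (A * T),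
     (forall y, y \in s -> koszulW n y.2) /\
     forall w, mcoeff w t = \sum_(y <- s) mcoeff w y.2 *: y.1].

(* rho i = m i / 2 for i even and m (i - 1) / 2 + 1 for i odd *)
Definition rho (i : nat) : nat := (m * i./2 + odd i)%N.

(* The coefficient at v of the image of t under
   a (x) v_1 ... v_n |-> a v_1 ... v_r (x) v_{r+1} ... v_n. *)
Definition koszul_d (r : nat) (t : AT) (v : seq 'I_g) : A :=
  \sum_(u : r.-tuple 'I_g) mcoeff (FMonom (u ++ v)) t * \prod_(i <- u) x i.

(* Exactness of ... -> A (x) W_{rho 2} -> A (x) W_{rho 1} -> A -> K -> 0. *)
Definition koszul_exact : Prop :=
  (forall a : A, conn_aug G a = 0 -> exists s : AT,
     AkoszulW (rho 1) s /\ koszul_d (rho 1 - rho 0) s [::] = a) /\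
  (forall (i : nat) (t : AT), AkoszulW (rho i.+1) t ->
     (forall v, koszul_d (rho i.+1 - rho i) t v = 0) ->
     exists s : AT, AkoszulW (rho i.+2) s /\
       forall v, koszul_d (rho i.+2 - rho i.+1) s v = mcoeff (FMonom v) t).

End Koszul.

Definition m_Koszul (K : fieldType) (A : algType K) (G : connected_grading A)
    (m : nat) : Prop :=
  (2 <= m)%N /\
  exists (g : nat) (x : 'I_g -> A) (Rel : set (malg (fmonom 'I_g) K)),
    [/\ is_basis_of_A1 G x, subspace Rel, Rel `<=` @tensor_power K g m,
        presented x Rel & koszul_exact G m x Rel].

(* V (x) W for W finite-dimensional: the tensor sum_i v_i (x) b_i, with b the
   chosen basis of W, is stored as i |-> v_i. *)
Definition tensor (K : fieldType) (V : lmodType K) (W : vectType K) : Type :=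
  {ffun 'I_(\dim {:W}) -> V}.
HB.instance Definition _ (K : fieldType) (V : lmodType K) (W : vectType K) :=
  GRing.Lmodule.on (tensor V W).

Section Tensor.
Variables (K : fieldType) (V : lmodType K) (W : vectType K).

Definition tens (v : V) (w : W) : tensor V W :=
  [ffun i => coord (vbasis {:W}) i w *: v].

(* The map V (x) W -> U induced by a bilinear map V -> W -> U. *)
Definition tlift (U : lmodType K) (beta : V -> W -> U) (t : tensor V W) : U :=
  \sum_i beta (t i) (vbasis {:W})`_i.

Definition bilinear_map (U : lmodType K) (beta : V -> W -> U) : Prop :=
  (forall w, linear (beta^~ w)) /\ (forall v, linear (beta v)).

End Tensor.

Section TensorTheory.
Variable K : fieldType.
Implicit Types (V U : lmodType K) (W : vectType K).

Lemma lin0 V U (f : V -> U) : linear f -> f 0 = 0.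
Proof. by move=> h; have := h (-1) 0 0; rewrite scaler0 addr0 scaleN1r addNr. Qed.
Lemma linZ V U (f : V -> U) : linear f -> forall c u, f (c *: u) = c *: f u.
Proof. by move=> h c u; have := h c u 0; rewrite !addr0 (lin0 h) addr0. Qed.
Lemma linD V U (f : V -> U) : linear f -> {morph f : x y / x + y}.
Proof. by move=> h x y; have := h 1 x y; rewrite !scale1r. Qed.
Lemma lin_sum V U (f : V -> U) : linear f -> forall (I : Type) (s : seq I) P F,
  f (\sum_(i <- s | P i) F i) = \sum_(i <- s | P i) f (F i).
Proof. by move=> h I s P F; apply: (big_morph f (linD h) (lin0 h)). Qed.

Lemma tlift_tens V W U (beta : V -> W -> U) v w :
  bilinear_map beta -> tlift beta (tens v w) = beta v w.
Proof.
move=> [hl hr]; rewrite /tlift.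
rewrite [in RHS](coord_vbasis (memvf w)) (lin_sum (hr v)).
by apply: eq_bigr => i _; rewrite ffunE (linZ (hl _)) (linZ (hr _)).
Qed.

Lemma tens_bilinear V W : bilinear_map (@tens K V W).
Proof.
split=> [w c u v|v c u w]; apply/ffunP => i; rewrite !ffunE.
  by rewrite scalerDr !scalerA mulrC.
by rewrite linearP scalerDl scalerA.
Qed.

Lemma tlift_linear V W U (beta : V -> W -> U) :
  (forall w, linear (beta^~ w)) -> linear (tlift beta).
Proof.
move=> h c s t; rewrite /tlift scaler_sumr -big_split; apply: eq_bigr => i _.
by rewrite /= !ffunE h.
Qed.

Lemma tensor_decomp V W (t : tensor V W) :
  t = \sum_i tens (t i) (vbasis {:W})`_i.
Proof.
apply/ffunP => i; rewrite sum_ffunE (bigD1 i) //= big1 => [|j ji].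
  by rewrite ffunE coord_free ?(basis_free (vbasisP _)) // eqxx scale1r addr0.
rewrite ffunE coord_free ?(basis_free (vbasisP _)) //.
by rewrite (negbTE ji) scale0r.
Qed.

Lemma tensor_ext V W U (f h : tensor V W -> U) : linear f -> linear h ->
  (forall v w, f (tens v w) = h (tens v w)) -> f =1 h.
Proof.
move=> lf lh fh t; rewrite (tensor_decomp t) (lin_sum lf) (lin_sum lh).
by apply: eq_bigr.
Qed.

Lemma tlift_comp V W U U' (f : U -> U') (beta : V -> W -> U) t :
  linear f -> f (tlift beta t) = tlift (fun v w => f (beta v w)) t.
Proof. by move=> h; rewrite /tlift (lin_sum h). Qed.

Lemma eq_tlift V W U (beta gamma : V -> W -> U) t :
  (forall v w, beta v w = gamma v w) -> tlift beta t = tlift gamma t.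
Proof. by move=> h; rewrite /tlift; apply: eq_bigr. Qed.

Lemma tlift_lin_param V W U (X : lmodType K) (beta : X -> V -> W -> U) t :
  (forall v w, linear (fun p => beta p v w)) -> linear (fun p => tlift (beta p) t).
Proof.
move=> h c p q; rewrite /tlift scaler_sumr -big_split; apply: eq_bigr => i _.
exact: h.
Qed.

Lemma lin_id V : linear (fun v : V => v). Proof. by []. Qed.
Lemma lin_comp V U (X : lmodType K) (f : U -> X) (h : V -> U) :
  linear f -> linear h -> linear (fun v => f (h v)).
Proof. by move=> lf lh c u v; rewrite lh lf. Qed.

End TensorTheory.

Section HopfAlgebras.
Variable K : fieldType.

Definition tensor_mul (H : falgType K) (s t : tensor H H) : tensor H H :=
  tlift (fun a b => tlift (fun c d => tens (a * c) (b * d)) t) s.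

Record hopf_structure (H : falgType K) := HopfStructure {
  coprod : {linear H -> tensor H H};
  counit : {scalar H};
  antipode : {linear H -> H};
  coprod1 : coprod 1 = tens 1 1;
  coprodM : forall g h, coprod (g * h) = tensor_mul (coprod g) (coprod h);
  counit1 : counit 1 = 1;
  counitM : forall g h, counit (g * h) = counit g * counit h;
  coprodA : forall h,
    tlift (fun x y => tens (coprod x) y) (coprod h) =
    tlift (fun x y => tlift (fun u v => tens (tens x u) v) (coprod y)) (coprod h);
  counitl : forall h, tlift (fun x y => counit x *: y) (coprod h) = h;
  counitr : forall h, tlift (fun x y => counit y *: x) (coprod h) = h;
  antipodel : forall h,
    tlift (fun x y => antipode x * y) (coprod h) = (counit h)%:A;
  antipoder : forall h,
    tlift (fun x y => x * antipode y) (coprod h) = (counit h)%:A }.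

(* Every left ideal is a direct summand of the regular module. *)
Definition semisimple_algebra (H : falgType K) : Prop :=
  let left_ideal (I : {vspace H}) := forall h x : H, x \in I -> h * x \in I in
  forall I, left_ideal I -> exists J : {vspace H},
    [/\ left_ideal J, (I + J = fullv)%VS & (I :&: J = 0)%VS].

Definition hopf_ideal (H : falgType K) (Hs : hopf_structure H)
    (I : {vspace H}) : Prop :=
  [/\ forall g h x : H, x \in I -> g * x * h \in I,
      forall x, x \in I -> exists s : seq (H * H),
        (forall y, y \in s -> y.1 \in I \/ y.2 \in I) /\
        coprod Hs x = \sum_(y <- s) tens y.1 y.2,
      forall x, x \in I -> counit Hs x = 0 &
      forall x, x \in I -> antipode Hs x \in I].

End HopfAlgebras.

(* A is a left H-module algebra, each A_n being an H-submodule. *)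
Record hopf_action (K : fieldType) (H : falgType K) (Hs : hopf_structure H)
    (A : algType K) (G : connected_grading A) := HopfAction {
  act :> H -> A -> A;
  act_bilinear : bilinear_map (fun a h => act h a);
  act1 : forall a, act 1 a = a;
  actM : forall g h a, act (g * h) a = act g (act h a);
  act_mul : forall h a b,
    act h (a * b) = tlift (fun x y => act x a * act y b) (coprod Hs h);
  act_one : forall h, act h 1 = (counit Hs h)%:A;
  act_deg : forall n h a, G n a -> G n (act h a) }.

Definition smash (K : fieldType) (H : falgType K) (Hs : hopf_structure H)
  (A : algType K) (G : connected_grading A) (M : hopf_action Hs G) : Type :=
  tensor A H.

Section SmashProduct.
Variables (K : fieldType) (H : falgType K) (Hs : hopf_structure H).
Variables (A : algType K) (G : connected_grading A) (M : hopf_action Hs G).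
Local Notation AH := (smash M).
HB.instance Definition _ := GRing.Lmodule.copy AH (tensor A H).

Definition smash_mul (x y : AH) : AH :=
  tlift (fun a h => tlift (fun b k =>
    tlift (fun h1 h2 => tens (a * M h1 b) (h2 * k)) (coprod Hs h)) y) x.

Definition smash_one : AH := tens 1 1.

Let lmul (B : algType K) (b : B) : linear (fun x => b * x).
Proof. by move=> c u v; rewrite mulrDr scalerAr. Qed.
Let rmul (B : algType K) (b : B) : linear (fun x => x * b).
Proof. by move=> c u v; rewrite mulrDl scalerAl. Qed.
Let actl h : linear (fun a => M h a). Proof. exact: (act_bilinear M).1. Qed.
Let actr a : linear (fun h => M h a). Proof. exact: (act_bilinear M).2. Qed.
Let tensl (V : lmodType K) (W : vectType K) w : linear (fun v : V => @tens K V W v w).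
Proof. exact: (tens_bilinear V W).1. Qed.
Let tensr (V : lmodType K) (W : vectType K) v : linear (fun w : W => @tens K V W v w).
Proof. exact: (tens_bilinear V W).2. Qed.
Let cop : linear (coprod Hs). Proof. by move=> c u v; rewrite linearP. Qed.

Ltac lin := cbv beta; match goal with
  | |- linear (fun p => p) => exact: lin_id
  | |- linear (fun p => tlift (@?F p) ?t) => apply: tlift_lin_param; intros; lin
  | |- linear (fun p => tlift ?F (@?X p)) =>
      refine (@lin_comp _ _ _ _ (tlift F) X _ _);
        [apply: tlift_linear; intros; lin | lin]
  | |- linear (fun p => tens (@?X p) ?w) =>
      refine (@lin_comp _ _ _ _ (fun v => tens v w) X (@tensl _ _ w) _); lin
  | |- linear (fun p => tens ?v (@?X p)) =>
      refine (@lin_comp _ _ _ _ (fun w => tens v w) X (@tensr _ _ v) _); lin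
  | |- linear (fun p => act _ ?h (@?X p)) =>
      refine (@lin_comp _ _ _ _ (fun a => M h a) X (@actl h) _); lin
  | |- linear (fun p => act _ (@?X p) ?a) =>
      refine (@lin_comp _ _ _ _ (fun h => M h a) X (@actr a) _); lin
  | |- linear (fun p => ?b * (@?X p)) =>
      refine (@lin_comp _ _ _ _ (fun a => b * a) X (@lmul _ b) _); lin
  | |- linear (fun p => (@?X p) * ?b) =>
      refine (@lin_comp _ _ _ _ (fun a => a * b) X (@rmul _ b) _); lin
  | |- linear (fun p => GRing.Linear.sort _ (@?X p)) =>
      refine (@lin_comp _ _ _ _ (coprod Hs) X cop _); lin
  | |- linear ?f => change (linear (fun p => f p)); fail 1
  end.

Lemma smash_mul_linl y : linear (fun x => smash_mul x y).
Proof. rewrite /smash_mul. lin. Qed.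
Lemma smash_mul_linr x : linear (fun y => smash_mul x y).
Proof. rewrite /smash_mul. lin. Qed.

Lemma smash_mul_tens a h b k : smash_mul (tens a h) (tens b k) =
  tlift (fun h1 h2 => tens (a * M h1 b) (h2 * k)) (coprod Hs h).
Proof.
rewrite /smash_mul tlift_tens; last by split => ?; lin.
by rewrite tlift_tens; last by split => ?; lin.
Qed.

Let cnt : linear (fun h => counit Hs h : K^o).
Proof. by move=> c u v; rewrite linearP. Qed.
Let scl (V : lmodType K) (v : V) : linear (fun c : K^o => (c : K) *: v).
Proof. by move=> c a b; rewrite scalerDl scalerA. Qed.
Let scr (V : lmodType K) (c : K) : linear (fun v : V => c *: v).
Proof. by move=> d u v; rewrite scalerDr !scalerA mulrC. Qed.

Lemma coassoc_lift (U : lmodType K) (F : H -> H -> H -> U) h :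
  (forall y z, linear (fun x => F x y z)) ->
  (forall x z, linear (fun y => F x y z)) ->
  (forall x y, linear (fun z => F x y z)) ->
  tlift (fun x y => tlift (F x) (coprod Hs y)) (coprod Hs h) =
  tlift (fun x z => tlift (fun u v => F u v z) (coprod Hs x)) (coprod Hs h).
Proof.
move=> F1 F2 F3.
pose Phi := tlift (fun (xy : tensor H H) z => tlift (fun x y => F x y z) xy).
have bPhi : bilinear_map (fun (xy : tensor H H) z => tlift (fun x y => F x y z) xy).
  by split=> [z|xy]; [apply: tlift_linear | apply: tlift_lin_param].
have lPhi : linear Phi by apply: tlift_linear; exact: bPhi.1.
have := congr1 Phi (coprodA Hs h).
rewrite !(tlift_comp _ _ lPhi) => E; symmetry.
transitivity (tlift (fun x y => Phi (tens (coprod Hs x) y)) (coprod Hs h)).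
  by apply: eq_tlift => x y; rewrite /Phi tlift_tens.
rewrite E; apply: eq_tlift => x y; rewrite (tlift_comp _ _ lPhi).
by apply: eq_tlift => u v; rewrite /Phi tlift_tens // tlift_tens.
Qed.

Lemma coprodM_lift (U : lmodType K) (F : H -> H -> U) g h : bilinear_map F ->
  tlift F (coprod Hs (g * h)) =
  tlift (fun x y => tlift (fun u v => F (x * u) (y * v)) (coprod Hs h))
    (coprod Hs g).
Proof.
move=> [F1 F2]; have lF : linear (tlift F) by apply: tlift_linear.
rewrite coprodM /tensor_mul (tlift_comp _ _ lF).
apply: eq_tlift => x y; rewrite (tlift_comp _ _ lF).
by apply: eq_tlift => u v; rewrite tlift_tens.
Qed.

Lemma exchange_tlift (V V' U : lmodType K) (W W' : vectType K)
    (F : V -> W -> V' -> W' -> U) (s : tensor V W) (t : tensor V' W') :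
  tlift (fun a b => tlift (F a b) t) s =
  tlift (fun c d => tlift (fun a b => F a b c d) s) t.
Proof. exact: exchange_big. Qed.

Lemma smash_mulA : associative smash_mul.
Proof.
move=> x y z.
apply: (@tensor_ext _ _ _ _ (fun x => smash_mul x (smash_mul y z))
          (fun x => smash_mul (smash_mul x y) z)) => [||a h].
- exact: smash_mul_linl.
- by apply: (lin_comp (smash_mul_linl z)); exact: smash_mul_linl.
apply: (@tensor_ext _ _ _ _ (fun y => smash_mul (tens a h) (smash_mul y z))
          (fun y => smash_mul (smash_mul (tens a h) y) z)) => [||b k].
- by apply: (lin_comp (smash_mul_linr _)); exact: smash_mul_linl.
- by apply: (lin_comp (smash_mul_linl _)); exact: smash_mul_linr.
apply: (@tensor_ext _ _ _ _
          (fun z => smash_mul (tens a h) (smash_mul (tens b k) z))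
          (fun z => smash_mul (smash_mul (tens a h) (tens b k)) z)) => [||c l].
- by apply: (lin_comp (smash_mul_linr _)); exact: smash_mul_linr.
- exact: smash_mul_linr.
rewrite !smash_mul_tens (tlift_comp _ _ (@smash_mul_linr _)).
rewrite (tlift_comp _ _ (@smash_mul_linl _)).
transitivity (tlift (fun h1 h2 => tlift (fun k1 k2 => tlift (fun u v =>
    tens (a * (M u b * M (v * k1) c)) (h2 * (k2 * l))) (coprod Hs h1))
      (coprod Hs k)) (coprod Hs h)).
  rewrite exchange_tlift; apply: eq_tlift => k1 k2; rewrite smash_mul_tens.
  apply: eq_tlift => h1 h2; rewrite act_mul.
  have L : linear (fun w => tens (a * w) (h2 * (k2 * l))) by lin.
  by rewrite (tlift_comp _ _ L); apply: eq_tlift => u v; rewrite actM.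
transitivity (tlift (fun k1 k2 => tlift (fun h1 h2 => tlift (fun u v =>
    tens (a * (M u b * M (v * k1) c)) (h2 * (k2 * l))) (coprod Hs h1))
      (coprod Hs h)) (coprod Hs k)).
  exact: exchange_tlift.
transitivity (tlift (fun k1 k2 => tlift (fun h1 h2 => tlift (fun v w =>
    tens (a * (M h1 b * M (v * k1) c)) (w * (k2 * l))) (coprod Hs h2))
      (coprod Hs h)) (coprod Hs k)).
  apply: eq_tlift => k1 k2; symmetry.
  apply: (@coassoc_lift _ (fun u v w =>
    tens (a * (M u b * M (v * k1) c)) (w * (k2 * l)))) => *; lin.
rewrite exchange_tlift; apply: eq_tlift => h1 h2; rewrite smash_mul_tens.
rewrite coprodM_lift; last by split=> ?; lin.
rewrite exchange_tlift; apply: eq_tlift => u v.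
by apply: eq_tlift => p q; rewrite !mulrA.
Qed.

Lemma smash_mul1x : left_id smash_one smash_mul.
Proof.
apply: (@tensor_ext _ _ _ _ (fun x => smash_mul smash_one x) id) => [||b k].
- exact: smash_mul_linr.
- exact: lin_id.
rewrite smash_mul_tens coprod1 tlift_tens; last by split=> ?; lin.
by rewrite act1 !mul1r.
Qed.

Lemma smash_mulx1 : right_id smash_one smash_mul.
Proof.
apply: (@tensor_ext _ _ _ _ (fun x => smash_mul x smash_one) id) => [||a h].
- exact: smash_mul_linl.
- exact: lin_id.
rewrite smash_mul_tens /= -[in RHS](counitl Hs h).
have L : linear (fun w : H => tens a w) by lin.
rewrite (tlift_comp _ _ L); apply: eq_tlift => x y.
rewrite act_one mulr1 -scalerAr mulr1.
by rewrite (linZ (tensl _)) (linZ (tensr _)).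
Qed.

Lemma smash_mulDl : left_distributive smash_mul +%R.
Proof. by move=> x y z; exact: (linD (smash_mul_linl z)). Qed.
Lemma smash_mulDr : right_distributive smash_mul +%R.
Proof. by move=> x y z; exact: (linD (smash_mul_linr x)). Qed.

Let eps_lin (x : A) : linear (fun h => counit Hs h *: x).
Proof. by apply: (lin_comp (scl x)); exact: cnt. Qed.

Lemma smash_one_neq0 : smash_one != 0.
Proof.
pose f : tensor A H -> A := tlift (fun a h => counit Hs h *: a).
have lf : linear f by apply: tlift_linear => h; exact: scr.
apply/eqP => e0; have := congr1 f e0; rewrite (lin0 lf) /f tlift_tens.
  by rewrite counit1 scale1r => /eqP; rewrite oner_eq0.
by split=> ?; [exact: scr | exact: eps_lin].
Qed.

HB.instance Definition _ := GRing.Zmodule_isNzRing.Build AH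
  smash_mulA smash_mul1x smash_mulx1 smash_mulDl smash_mulDr smash_one_neq0.

Fact smash_scalerAl (c : K) (x y : AH) : c *: (x * y) = (c *: x : AH) * y.
Proof. by rewrite [RHS](linZ (smash_mul_linl y)). Qed.
HB.instance Definition _ :=
  GRing.LSemiModule_isLSemiAlgebra.Build K AH smash_scalerAl.

Fact smash_scalerAr (c : K) (x y : AH) : c *: (x * y) = x * (c *: y : AH).
Proof. by rewrite [RHS](linZ (smash_mul_linr x)). Qed.
HB.instance Definition _ :=
  GRing.LSemiAlgebra_isSemiAlgebra.Build K AH smash_scalerAr.

Definition smashA (a : A) : AH := tens a 1.
Definition smashH (h : H) : AH := tens 1 h.

(* H is placed in degree 0. *)
Definition smash_deg (n : nat) : set AH := [set x | forall i, G n ((x : tensor A H) i)].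

(* The augmentation a # h |-> conn_aug a * counit h. *)
Definition smash_aug (x : AH) : K :=
  tlift (fun a h => (conn_aug G a * counit Hs h : K^o)) x.

Let augZ c a : conn_aug G (c *: a) = c * conn_aug G a.
Proof. by rewrite -mulr_algl rmorphM conn_aug_scalar. Qed.

Lemma conn_aug_act h a : conn_aug G (M h a) = counit Hs h * conn_aug G a.
Proof.
have [_ dec _] := conn_direct G.
have [s [f [Gf ->]]] := dec a.
rewrite (lin_sum (actl h)) !rmorph_sum mulr_sumr; apply: eq_bigr => i _.
case: (posnP i) => [i0|ipos].
  have [c ->] := (conn_deg0 G (f i)).1 (ltac:(rewrite -{1}i0; exact: Gf)).
  by rewrite (linZ (actl h)) act_one !augZ rmorph1 !mulr1 mulrC.
by rewrite !(conn_aug_pos ipos) ?mulr0 //; apply: act_deg.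
Qed.

Fact smash_aug_linear : linear (smash_aug : AH -> K^o).
Proof.
apply: tlift_linear => h c u v.
by rewrite /= rmorphD augZ mulrDl -mulrA.
Qed.

Lemma smash_aug_tens a h : smash_aug (tens a h) = conn_aug G a * counit Hs h.
Proof.
rewrite /smash_aug tlift_tens //; split=> [k c u v|b c u v].
  by rewrite /= rmorphD augZ mulrDl -mulrA.
by rewrite linearP mulrDr mulrCA.
Qed.

Fact smash_aug_nmod : nmod_morphism smash_aug.
Proof.
by split; [exact: (lin0 smash_aug_linear) | exact: (linD smash_aug_linear)].
Qed.

Fact smash_aug_monoid : monoid_morphism smash_aug.
Proof.
split=> [|x y]; first by rewrite smash_aug_tens rmorph1 counit1 mulr1.
apply: (@tensor_ext _ _ _ (K^o : lmodType K) (fun x => smash_aug (smash_mul x y))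
  (fun x => (smash_aug x * smash_aug y))) => [||a h].
- by apply: (lin_comp smash_aug_linear); exact: smash_mul_linl.
- by move=> c u v; rewrite smash_aug_linear mulrDl scalerAl.
apply: (@tensor_ext _ _ _ (K^o : lmodType K) (fun y => smash_aug (smash_mul (tens a h) y))
  (fun y => (smash_aug (tens a h) * smash_aug y))) => [||b k].
- by apply: (lin_comp smash_aug_linear); exact: smash_mul_linr.
- by move=> c u v; rewrite smash_aug_linear mulrDr scalerAr.
rewrite smash_mul_tens (tlift_comp _ _ smash_aug_linear) !smash_aug_tens.
rewrite -[in RHS](counitl Hs h).
pose f (w : H) : K^o := conn_aug G a * counit Hs w * (conn_aug G b * counit Hs k).
have lf : linear f.
  by move=> c u v; rewrite /f linearP /GRing.scale /=; ring.
rewrite -[RHS]/(f _) (tlift_comp _ _ lf); apply: eq_tlift => u v.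
rewrite smash_aug_tens rmorphM conn_aug_act counitM /f linearZ /=; ring.
Qed.

HB.instance Definition _ :=
  GRing.isNmodMorphism.Build AH K smash_aug smash_aug_nmod.
HB.instance Definition _ :=
  GRing.isMonoidMorphism.Build AH K smash_aug smash_aug_monoid.

End SmashProduct.

Section AuslanderMap.
Variables (K : fieldType) (H : falgType K) (Hs : hopf_structure H).
Variables (A : algType K) (G : connected_grading A) (M : hopf_action Hs G).

Definition invariants : set A := [set a | forall h, M h a = counit Hs h *: a].

(* The endomorphisms of A as a right module over the invariants. *)
Definition End_invariants : set (A -> A) :=
  [set f : A -> A | {morph f : a b / a + b} /\
           forall a b, invariants b -> f (a * b) = f a * b].

Definition auslander (x : smash M) : A -> A :=
  fun b => tlift (fun a h => a * M h b) x.

Let auslander_bilinear b : bilinear_map (fun a h => a * M h b).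
Proof.
split=> [h c u v|a c u v]; first by rewrite mulrDl scalerAl.
by rewrite (act_bilinear M).2 mulrDr scalerAr.
Qed.

Lemma auslander_tens a h b : auslander (tens a h) b = a * M h b.
Proof. by rewrite /auslander tlift_tens. Qed.

Lemma auslander_linear b : linear (fun x : smash M => auslander x b).
Proof. by apply: tlift_linear; exact: (auslander_bilinear b).1. Qed.

Let auslander_linear2 x : linear (auslander x).
Proof.
apply: tlift_lin_param => a h c u v.
by rewrite (act_bilinear M).1 mulrDr scalerAr.
Qed.

Lemma auslander1 : auslander 1 = id.
Proof. by apply: funext => b; rewrite auslander_tens act1 mul1r. Qed.

Lemma auslanderM (x y : smash M) :
  auslander (x * y) = auslander x \o auslander y.
Proof.
apply: funext => c /=.
apply: (@tensor_ext _ _ _ _ (fun x => auslander (smash_mul x y) c)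
  (fun x => auslander x (auslander y c))) => [||a h].
- by apply: (lin_comp (auslander_linear c)); exact: smash_mul_linl.
- exact: auslander_linear.
apply: (@tensor_ext _ _ _ _ (fun y => auslander (smash_mul (tens a h) y) c)
  (fun y => auslander (tens a h) (auslander y c))) => [||b k].
- by apply: (lin_comp (auslander_linear c)); exact: smash_mul_linr.
- by apply: (lin_comp (auslander_linear2 _)); exact: auslander_linear.
rewrite smash_mul_tens (tlift_comp _ _ (auslander_linear c)) !auslander_tens.
rewrite act_mul.
have L : linear (fun w : A => a * w) by move=> d u v; rewrite mulrDr scalerAr.
rewrite (tlift_comp _ _ L); apply: eq_tlift => u v.
by rewrite auslander_tens actM mulrA.
Qed.

(* The Auslander map is always a morphism of algebras into End_invariants, by
   the lemmas above, so it is an isomorphism iff it is bijective. *)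
Lemma auslander_End (x : smash M) : End_invariants (auslander x).
Proof.
split=> [a b|a b inv_b]; first exact: (linD (auslander_linear2 x)).
rewrite /auslander.
have L : linear (fun w : A => w * b) by move=> d u v; rewrite mulrDl scalerAl.
rewrite (tlift_comp _ _ L); apply: eq_tlift => c h.
rewrite act_mul -mulrA; congr (_ * _).
have L' : linear (fun w : H => M w a * b).
  by move=> d u v; rewrite (act_bilinear M).2 mulrDl scalerAl.
rewrite -[in RHS](counitr Hs h) (tlift_comp _ _ L'); apply: eq_tlift => u v.
by rewrite (linZ L') inv_b scalerAr.
Qed.

Definition auslander_iso : Prop := set_bij [set: smash M] End_invariants auslander.

Definition inner_faithful : Prop :=
  forall I : {vspace H}, hopf_ideal Hs I -> I != 0%VS ->
  exists h a, h \in I /\ M h a <> 0.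

End AuslanderMap.

Section HomologicalDeterminant.
Variables (K : fieldType) (H : falgType K) (Hs : hopf_structure H).
Variables (A : algType K) (G : connected_grading A) (M : hopf_action Hs G).

Definition smash_resolution :=
  @graded_resolution K (smash M) (@smash_deg _ _ _ _ _ M) (@smash_aug _ _ _ _ _ M).

(* The A-linear maps P_k -> K. *)
Definition A_hom (P : smash_resolution) (k : nat) (f : P k -> K) : Prop :=
  {morph f : p q / p + q} /\
  forall a p, f (smashA M a *: p) = conn_aug G a * f p.

(* h . f = f (S^-1 (h) -), where S^-1 = S since S^2 = id. *)
Definition hom_act (P : smash_resolution) (k : nat) (h : H) (f : P k -> K) :
  P k -> K := fun p => f (smashH M (antipode Hs h) *: p).

(* hd = eta \o S, where H acts on the line Ext^d_A(K, K) by the character eta. *)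
Definition is_hdet (d : nat) (hd : H -> K) : Prop :=
  exists (P : smash_resolution) (eta : H -> K),
    (forall h (f : P d -> K), cocycle (@A_hom P) f ->
       coboundary (@A_hom P) (fun p => hom_act h f p - eta h * f p)) /\
    forall h, hd h = eta (antipode Hs h).

Definition Xi (hd : H -> K) (h : H) : H :=
  tlift (fun x y => hd x *: y) (coprod Hs h).

End HomologicalDeterminant.

Section Idempotents.
Variables (K : fieldType) (H : falgType K) (Hs : hopf_structure H).

Definition irreducible_module (V : lmodType H) : Prop :=
  (exists v : V, v != 0) /\
  forall W : set V, W 0 -> (forall h u v, W u -> W v -> W (h *: u + v)) ->
    W = [set 0] \/ W = [set: V].

Definition isomorphic_modules (V W : lmodType H) : Prop :=
  exists f : {linear V -> W}, bijective f.

(* H x, for x idempotent, is isomorphic to V: every H-linear map from the direct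
   summand H x of H extends to H. *)
Definition principal_iso (x : H) (V : lmodType H) : Prop :=
  exists f : {linear H^o -> V},
    (forall h : H, f (h * x) = 0 -> h * x = 0) /\
    forall v, exists h : H, f (h * x) = v.

(* V_0, ..., V_n are the irreducible modules, V_0 being trivial, the e_i are
   pairwise orthogonal idempotents, and H e_i is isomorphic to V_i. *)
Definition basic_idempotents (n : nat) (e : 'I_n.+1 -> H) : Prop :=
  (forall i j, e i * e j = if i == j then e i else 0) /\
  exists V : 'I_n.+1 -> lmodType H,
    [/\ forall i, irreducible_module (V i),
        forall i j, isomorphic_modules (V i) (V j) -> i = j,
        forall W, irreducible_module W -> exists i, isomorphic_modules W (V i),
        forall h (v : V ord0), h *: v = (counit Hs h)%:A *: v &
        forall i, principal_iso (e i) (V i)].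

End Idempotents.

(* Lambda = e (A # H) e for e = sum_i e_i, as a subspace of A # H closed under
   products, and its ideal generated by e_0. *)
Section Lambda.
Variables (K : fieldType) (H : falgType K) (Hs : hopf_structure H).
Variables (A : algType K) (G : connected_grading A) (M : hopf_action Hs G).
Variables (n : nat) (e : 'I_n.+1 -> H).

Definition Lambda : set (smash M) :=
  let E := smashH M (\sum_i e i) in [set x | exists y, x = E * y * E].

Definition Lambda_e0 : set (smash M) :=
  ideal_in Lambda [set smashH M (e ord0)].

End Lambda.
Arguments Lambda {K H Hs A G} M {n} e.
Arguments Lambda_e0 {K H Hs A G} M {n} e.

(* Main.v *)
(* Write B = A # H, let E = 1 # e_0, where e_0 is the normalized two-sided integral
   of H, and let I = B E B.  Since B E is A and E B E is A^H, the Auslander map is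
   B -> End_{EBE}(BE), and it is bijective iff Hom_B(B/I, B) = Ext^1_B(B/I, B) = 0
   for right B-modules.  The extension A < B is Frobenius and separable: the
   integral yields a Casimir element of H which is central for the A-bimodule
   structure of B too, and the regular character of H is the Frobenius form.
   Hence these groups vanish iff Hom_A(B/I, A) = Ext^1_A(B/I, A) = 0, that is,
   iff B/I = 0 or j(B/I) >= 2, and by the Cohen-Macaulay property this is a
   condition on the Gelfand-Kirillov dimension of the right A-module B/I, which
   is finitely generated.  That dimension is the one of Lambda/<e_0>, because
   e = e_0 + ... + e_n is a full idempotent: H e H = H. *)
Require Import Defs.
From HB Require Import structures.
From mathcomp Require Import all_boot all_order all_algebra all_field.
From mathcomp Require Import all_classical all_reals all_analysis.

Set Implicit Arguments.
Unset Strict Implicit.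
Unset Printing Implicit Defensive.
Import Order.TTheory GRing.Theory Num.Theory.
Local Open Scope classical_set_scope.
Local Open Scope ring_scope.

(* MathComp-Analysis has a topological notion of the same name. *)
Local Notation subspace := Defs.subspace.

(** * Quotient modules *)

(** The second vanishing condition concerns maps on I because B is projective over itself: by the
    sequence 0 -> I -> B -> B/I -> 0, the group Ext^1_B(B/I, B) is Hom_B(I, B) modulo left
    multiplications. No Ext group over B is ever formed. The obstacle is that [Ext_zero] speaks of
    some resolution, possibly a different one in each degree. No comparison of resolutions is made.
    For an arbitrary projective resolution P of N = B/I over [A^c], vanishing in degrees 0 and 1 is
    translated into [ideal_faithful] and [ideal_hom_inner], which do not mention P. The translation
    uses A-linear maps beta : P_0 -> B and alpha : B -> P_0 over N, inverse to each other only
    modulo I and ker(P_0 -> N). Between A-linear and B-linear maps one passes by f |-> tau f and phi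
    |-> sum phi(- S(L_1)) L_2, where L = e_0. This needs tau to be linear over A on both sides; on
    the right this says that the regular trace is an integral of the dual of H. *)

Record submodule (R : nzRingType) (V : lmodType R) := Submodule {
  sub_set :> V -> Prop;
  sub_set0 : sub_set 0;
  sub_setP : forall r u v, sub_set u -> sub_set v -> sub_set (r *: u + v) }.

Section QuotientModule.
Local Open Scope quotient_scope.
Variables (R : nzRingType) (V : lmodType R) (W : submodule V).

Definition sub_pred : {pred V} := fun x => `[< W x >].

Fact sub_pred_zmod : zmod_closed sub_pred.
Proof.
split=> [|u v /asboolP Wu /asboolP Wv]; apply/asboolP; first exact: sub_set0.
by rewrite addrC -scaleN1r; apply: sub_setP.
Qed.
HB.instance Definition _ := GRing.isZmodClosed.Build V sub_pred sub_pred_zmod.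

Definition quotient_module : Type := Quotient.quot sub_pred.
HB.instance Definition _ := GRing.Zmodule.on quotient_module.

Definition quot_class (v : V) : quotient_module := \pi_(Quotient.quot sub_pred) v.

Lemma quot_class_eq u v : quot_class u = quot_class v <-> W (u - v).
Proof.
split=> [/eqP|Wuv]; first by rewrite /quot_class -Quotient.idealrBE => /asboolP.
by apply/eqP; rewrite /quot_class -Quotient.idealrBE; apply/asboolP.
Qed.

Lemma quot_class_surj x : exists v, quot_class v = x.
Proof. by exists (repr (x : Quotient.quot sub_pred)); exact: reprK. Qed.

Lemma quot_classD u v : quot_class (u + v) = quot_class u + quot_class v.
Proof. exact: raddfD. Qed.

Definition quot_scale (r : R) (x : quotient_module) : quotient_module :=
  quot_class (r *: repr (x : Quotient.quot sub_pred)).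

Lemma quot_scaleE r v : quot_scale r (quot_class v) = quot_class (r *: v).
Proof.
apply/quot_class_eq; rewrite -scalerBr -[X in W X]addr0.
apply: sub_setP; last exact: sub_set0.
by apply/quot_class_eq; exact: reprK.
Qed.

Fact quot_scaleA a b x : quot_scale a (quot_scale b x) = quot_scale (a * b) x.
Proof. by have [v <-] := quot_class_surj x; rewrite !quot_scaleE scalerA. Qed.
Fact quot_scale1 : left_id 1 quot_scale.
Proof. by move=> x; have [v <-] := quot_class_surj x; rewrite quot_scaleE scale1r. Qed.
Fact quot_scaleDr : right_distributive quot_scale +%R.
Proof.
move=> a x y; have [u <-] := quot_class_surj x; have [v <-] := quot_class_surj y.
by rewrite -quot_classD !quot_scaleE scalerDr quot_classD.
Qed.
Fact quot_scaleDl x : {morph quot_scale^~ x : a b / a + b}.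
Proof.
by move=> a b; have [v <-] := quot_class_surj x; rewrite !quot_scaleE scalerDl quot_classD.
Qed.
HB.instance Definition _ := GRing.Zmodule_isLmodule.Build R quotient_module
  quot_scaleA quot_scale1 quot_scaleDr quot_scaleDl.

Fact quot_class_linear : linear quot_class.
Proof. by move=> r u v; rewrite quot_classD -quot_scaleE. Qed.
HB.instance Definition _ :=
  GRing.isLinear.Build R V quotient_module _ quot_class quot_class_linear.

Lemma quot_class_eq0 v : quot_class v = 0 <-> W v.
Proof. by rewrite -(raddf0 quot_class) quot_class_eq subr0. Qed.

End QuotientModule.

(** * Hopf algebras *)

Section LinearMaps.
Variable K : fieldType.

Lemma lin_mull (B : algType K) (b : B) : linear (fun x => b * x).
Proof. by move=> c u v; rewrite mulrDr scalerAr. Qed.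
Lemma lin_mulr (B : algType K) (b : B) : linear (fun x => x * b).
Proof. by move=> c u v; rewrite mulrDl scalerAl. Qed.
Lemma lin_tensl (V : lmodType K) (W : vectType K) (w : W) :
  linear (fun v : V => tens v w).
Proof. exact: (tens_bilinear V W).1. Qed.
Lemma lin_tensr (V : lmodType K) (W : vectType K) (v : V) :
  linear (fun w : W => tens v w).
Proof. exact: (tens_bilinear V W).2. Qed.
Lemma lin_scalel (V : lmodType K) (v : V) : linear (fun c : K^o => (c : K) *: v).
Proof. by move=> c a b; rewrite scalerDl scalerA. Qed.
Lemma lin_scaler (V : lmodType K) (c : K) : linear (fun v : V => c *: v).
Proof. by move=> d u v; rewrite scalerDr !scalerA mulrC. Qed.
Lemma lin_map (V U : lmodType K) (f : {linear V -> U}) : linear f.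
Proof. by move=> c u v; rewrite linearP. Qed.
Lemma lin_form (V : lmodType K) (f : {scalar V}) : linear (f : V -> K^o).
Proof. by move=> c u v; rewrite linearP. Qed.
Lemma lin_add (V U : lmodType K) (f g : V -> U) : linear f -> linear g ->
  linear (fun p => f p + g p).
Proof. by move=> lf lg c u v; rewrite lf lg scalerDr addrACA. Qed.
Lemma lin_opp (V U : lmodType K) (f : V -> U) : linear f ->
  linear (fun p => - f p).
Proof. by move=> lf c u v; rewrite lf opprD scalerN. Qed.
Lemma lin_bigsum (V U : lmodType K) (I : Type) (s : seq I) (f : I -> V -> U) :
  (forall i, linear (f i)) -> linear (fun p => \sum_(i <- s) f i p).
Proof.
move=> lf c u v; rewrite scaler_sumr -big_split; apply: eq_bigr => i _; exact: lf.
Qed.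

End LinearMaps.

(** Sweedler sums are iterated [tlift]s, and rewriting under them requires linearity in one slot at
    a time. The tactic proves this by recursion on the shape of the expression, ending with
    linearity hypotheses from the context. *)
Ltac lin := cbv beta; match goal with
  | |- linear (fun p => p) => exact: lin_id
  | |- linear (GRing.Linear.sort _) => first [exact: lin_map | exact: lin_form]
  | |- linear (GRing.mul _) => exact: lin_mull
  | |- linear (GRing.scale _) => exact: lin_scaler
  | H : linear ?f |- linear ?f => exact: H
  | H : forall _, linear ?f |- linear ?g => exact: H
  | H : forall _ _, linear ?f |- linear ?g => exact: H
  | |- linear (fun p => tlift (@?F p) ?t) => apply: tlift_lin_param; intros; lin
  | |- linear (fun p => tlift ?F (@?X p)) =>
      refine (@lin_comp _ _ _ _ (tlift F) X _ _);
        [apply: tlift_linear; intros; lin | lin]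
  | |- linear (fun p => tens (@?X p) ?w) =>
      refine (@lin_comp _ _ _ _ (fun v => tens v w) X (@lin_tensl _ _ _ w) _); lin
  | |- linear (fun p => tens ?v (@?X p)) =>
      refine (@lin_comp _ _ _ _ (fun w => tens v w) X (@lin_tensr _ _ _ v) _); lin
  | |- linear (fun p => ?b * (@?X p)) =>
      refine (@lin_comp _ _ _ _ (fun a => b * a) X (@lin_mull _ _ b) _); lin
  | |- linear (fun p => (@?X p) * ?b) =>
      refine (@lin_comp _ _ _ _ (fun a => a * b) X (@lin_mulr _ _ b) _); lin
  | |- linear (fun p => ?b *: (@?X p)) =>
      refine (@lin_comp _ _ _ _ (fun a => b *: a) X (@lin_scaler _ _ b) _); lin
  | |- linear (fun p => (@?X p) *: ?b) =>
      refine (@lin_comp _ _ _ _ _ _ (@lin_scalel _ _ b) _); lin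
  | |- linear (fun p => (@?X p) + (@?Y p)) => apply: lin_add; lin
  | |- linear (fun p => - (@?X p)) => apply: lin_opp; lin
  | |- linear (fun p => \sum_(i <- ?s) (@?X i p)) => apply: lin_bigsum => ?; lin
  | |- linear (fun p => act ?M ?h (@?X p)) =>
      refine (@lin_comp _ _ _ _ (fun a => act M h a) X ((act_bilinear M).1 h) _); lin
  | |- linear (fun p => act ?M (@?X p) ?a) =>
      refine (@lin_comp _ _ _ _ (fun h => act M h a) X ((act_bilinear M).2 a) _); lin
  | |- linear (fun p => GRing.Linear.sort _ (@?X p)) =>
      first [ refine (@lin_comp _ _ _ _ _ X (@lin_map _ _ _ _) _); lin
            | refine (@lin_comp _ _ _ _ _ X (@lin_form _ _ _) _); lin ]
  | |- linear (fun p => ?f (@?X p)) =>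
      match goal with
      | lf : linear _ |- _ => refine (@lin_comp _ _ _ _ _ _ lf _); lin
      end
  | |- linear (fun p => ?f (@?X p) ?q) =>
      match goal with
      | lf : forall _, linear _ |- _ =>
         refine (@lin_comp _ _ _ _ (f^~ q) X (lf q) _); lin
      end
  | |- linear (fun p => ?f ?q (@?X p)) =>
      match goal with
      | lf : forall _, linear _ |- _ =>
         refine (@lin_comp _ _ _ _ (f q) X (lf q) _); lin
      end
  end.

Section HopfAlgebra.
Variables (K : fieldType) (H : falgType K) (Hs : hopf_structure H).
Local Notation S := (antipode Hs).
Local Notation eps := (counit Hs).
Local Notation sw F h := (tlift F (coprod Hs h)).

(** Here [sw F h] is the Sweedler sum of F(h_1, h_2). This lemma and the next three are the Hopf
    axioms with a linear map applied, the form needed under further Sweedler sums. *)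
Lemma counitl_lift (U : lmodType K) (f : H -> U) h : linear f ->
  sw (fun x y => eps x *: f y) h = f h.
Proof.
move=> lf; rewrite -[in RHS](counitl Hs h) (tlift_comp _ _ lf).
by apply: eq_tlift => x y; rewrite (linZ lf).
Qed.
Lemma counitr_lift (U : lmodType K) (f : H -> U) h : linear f ->
  sw (fun x y => eps y *: f x) h = f h.
Proof.
move=> lf; rewrite -[in RHS](counitr Hs h) (tlift_comp _ _ lf).
by apply: eq_tlift => x y; rewrite (linZ lf).
Qed.
Lemma antipodel_lift (U : lmodType K) (f : H -> U) h : linear f ->
  sw (fun x y => f (S x * y)) h = eps h *: f 1.
Proof. by move=> lf; rewrite -(tlift_comp _ _ lf) antipodel (linZ lf). Qed.
Lemma antipoder_lift (U : lmodType K) (f : H -> U) h : linear f ->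
  sw (fun x y => f (x * S y)) h = eps h *: f 1.
Proof. by move=> lf; rewrite -(tlift_comp _ _ lf) antipoder (linZ lf). Qed.

Lemma antipode1 : S 1 = 1.
Proof.
have := antipodel Hs 1; rewrite coprod1 tlift_tens; last by split=> ?; lin.
by rewrite mulr1 counit1 scale1r.
Qed.

Lemma counit_antipode h : eps (S h) = eps h.
Proof.
have le : linear (fun x : H => eps x : K^o) by lin.
have l2 : linear (fun x : H => eps (S x) : K^o) by lin.
have := congr1 eps (antipodel Hs h); rewrite [RHS]linearZ /= counit1.
rewrite [X in _ = X -> _]mulr1 => <-.
rewrite -(counitr_lift h l2) (tlift_comp _ (coprod Hs h) le).
by apply: (@eq_tlift _ _ _ (K^o : lmodType K)) => x y; rewrite counitM mulrC.
Qed.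

(** Both sides are convolution inverses of the multiplication of H. The expression S(g_1 h_1) g_2
    h_2 S(h_3) S(g_3) gives S(g h) when collapsed from the right and S(h) S(g) when collapsed from
    the left. *)
Lemma antipodeM g h : S (g * h) = S h * S g.
Proof.
transitivity (sw (fun g1 y => sw (fun g2 g3 => sw (fun h1 z => sw (fun h2 h3 =>
   S (g1 * h1) * (g2 * ((h2 * S h3) * S g3))) z) h) y) g).
  transitivity (sw (fun g1 y => sw (fun g2 g3 => S (g1 * h) * (g2 * S g3)) y) g).
    transitivity (sw (fun g1 y => eps y *: S (g1 * h)) g).
      by rewrite counitr_lift //; lin.
    apply: eq_tlift => g1 y.
    rewrite (antipoder_lift (f := fun w => S (g1 * h) * w)) ?mulr1 //; lin.
  apply: eq_tlift => g1 y; apply: eq_tlift => g2 g3.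
  transitivity (sw (fun h1 z => eps z *: (S (g1 * h1) * (g2 * S g3))) h).
    by rewrite counitr_lift //; lin.
  apply: eq_tlift => h1 z; symmetry.
  rewrite (antipoder_lift (f := fun w => S (g1 * h1) * (g2 * (w * S g3)))) ?mul1r //; lin.
rewrite (coassoc_lift Hs (F := fun g1 g2 g3 => sw (fun h1 z => sw (fun h2 h3 =>
   S (g1 * h1) * (g2 * ((h2 * S h3) * S g3))) z) h));
  try by move=> *; lin.
transitivity (sw (fun x g3 => eps x *: (S h * S g3)) g); last first.
  by rewrite counitl_lift //; lin.
apply: eq_tlift => x g3.
transitivity (sw (fun z h3 => eps x *: (eps z *: (S h3 * S g3))) h); last first.
  by rewrite -(tlift_comp _ _ (@lin_scaler _ _ (eps x))) counitl_lift //; lin.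
transitivity (sw (fun z h3 => sw (fun g1 g2 => sw (fun h1 h2 =>
   (S (g1 * h1) * (g2 * h2)) * (S h3 * S g3)) z) x) h).
  rewrite [RHS]exchange_tlift; apply: eq_tlift => g1 g2.
  rewrite (coassoc_lift Hs (F := fun h1 h2 h3 =>
     S (g1 * h1) * (g2 * ((h2 * S h3) * S g3))));
  try by move=> *; lin.
  by apply: eq_tlift => z h3; apply: eq_tlift => h1 h2; rewrite !mulrA.
apply: eq_tlift => z h3.
rewrite -(coprodM_lift Hs (F := fun u v => S u * v * (S h3 * S g3))); last by split=> ?; lin.
rewrite (antipodel_lift (f := fun w => w * (S h3 * S g3))); last by lin.
by rewrite counitM mul1r scalerA.
Qed.

End HopfAlgebra.

(** * The Casimir element of the integral and the regular trace of H *)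

Section Integral.
Variables (K : fieldType) (H : falgType K) (Hs : hopf_structure H).
Local Notation S := (antipode Hs).
Local Notation eps := (counit Hs).
Local Notation sw F h := (tlift F (coprod Hs h)).
Hypothesis S2 : forall h, S (S h) = h.
Variable L : H.
Hypothesis integral_l : forall h, h * L = eps h *: L.
Hypothesis integral_norm : eps L = 1.

(** S(L) is a right integral by antimultiplicativity, and S(L) L computed in two ways gives S(L) =
    L. *)
Lemma integral_r h : L * h = eps h *: L.
Proof.
have SLh k : S L * k = eps k *: S L.
  by rewrite -{1}(S2 k) -antipodeM integral_l linearZ /= counit_antipode.
have -> : L = S L.
  have := SLh L; rewrite integral_norm scale1r => <-.
  by rewrite integral_l counit_antipode integral_norm scale1r.
exact: SLh.
Qed.

Lemma antipode_swap_lift (U : lmodType K) (f : H -> U) h : linear f ->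
  sw (fun x y => f (S y * x)) h = eps h *: f 1.
Proof.
move=> lf; have lS : linear (fun x => f (S x)) by lin.
have := antipodel_lift Hs h lS; rewrite antipode1 => <-.
by apply: eq_tlift => x y; rewrite antipodeM S2.
Qed.

(* The Casimir element S(L_1) (x) L_2 of H is central. *)
Lemma casimirl (U : lmodType K) (F : H -> H -> U) h : bilinear_map F ->
  sw (fun x y => F (h * S x) y) L = sw (fun x y => F (S x) (y * h)) L.
Proof.
move=> [F1 F2].
(* Replace L by L h_2, up to the counit, to get h_1 S(L_1 h_2) (x) L_2 h_3; then h_1 S(h_2)
   cancels. *)
transitivity (sw (fun h1 y => sw (fun h2 h3 =>
    sw (fun u v => F (h1 * S (u * h2)) (v * h3)) L) y) h).
  transitivity (sw (fun h1 y => eps y *: sw (fun u v => F (h1 * S u) v) L) h).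
    by rewrite (counitr_lift Hs (f := fun h1 => sw (fun u v => F (h1 * S u) v) L)) //; lin.
  apply: eq_tlift => h1 y; rewrite [RHS]exchange_tlift.
  rewrite -(coprodM_lift Hs (F := fun u v => F (h1 * S u) v)); last by split=> ?; lin.
  have l : linear (fun z => sw (fun u v => F (h1 * S u) v) z) by lin.
  by rewrite integral_r (linZ l).
rewrite (coassoc_lift Hs (F := fun h1 h2 h3 =>
    sw (fun u v => F (h1 * S (u * h2)) (v * h3)) L));
  try by move=> *; lin.
transitivity (sw (fun x h3 => sw (fun u v => eps x *: F (S u) (v * h3)) L) h).
  apply: eq_tlift => x h3; rewrite exchange_tlift; apply: eq_tlift => u v.
  rewrite -[S u in RHS]mul1r.
  rewrite -(antipoder_lift Hs (f := fun w => F (w * S u) (v * h3))); last by lin.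
  by apply: eq_tlift => h1 h2; rewrite antipodeM mulrA.
rewrite exchange_tlift; apply: eq_tlift => u v.
by rewrite (counitl_lift Hs (f := fun h3 => F (S u) (v * h3))) //; lin.
Qed.

(** With k = S(h), the left side is S(h_1 L_1) (x) S(h_3) h_2 L_2, and h L = eps(h) L removes the
    inner coproduct. The insertion of S(h_3) h_2, in this reversed order, relies on S^2 = id. *)
Lemma casimirr (U : lmodType K) (F : H -> H -> U) k : bilinear_map F ->
  sw (fun x y => F (S x * k) y) L = sw (fun x y => F (S x) (k * y)) L.
Proof.
move=> [F1 F2]; rewrite -(S2 k); set h := S k.
transitivity (sw (fun h1 y => sw (fun h2 h3 =>
    sw (fun u v => F (S (h1 * u)) (S h3 * h2 * v)) L) y) h).
  transitivity (sw (fun h1 y => eps y *: sw (fun u v => F (S (h1 * u)) v) L) h).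
    rewrite (counitr_lift Hs (f := fun h1 => sw (fun u v => F (S (h1 * u)) v) L)); last by lin.
    by apply: eq_tlift => u v; rewrite antipodeM.
  apply: eq_tlift => h1 y; rewrite exchange_tlift.
  rewrite (tlift_comp _ _ (@lin_scaler _ _ (eps y))); apply: eq_tlift => u v.
  rewrite (antipode_swap_lift (f := fun w => F (S (h1 * u)) (w * v))) ?mul1r //; lin.
rewrite (coassoc_lift Hs (F := fun h1 h2 h3 =>
    sw (fun u v => F (S (h1 * u)) (S h3 * h2 * v)) L));
  try by move=> *; lin.
transitivity (sw (fun x h3 => eps x *: sw (fun u v => F (S u) (S h3 * v)) L) h).
  apply: eq_tlift => x h3.
  have l : linear (fun z => sw (fun u v => F (S u) (S h3 * v)) z) by lin.
  rewrite -(linZ l) -integral_l.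
  rewrite (coprodM_lift Hs (F := fun u v => F (S u) (S h3 * v))); last by split=> ?; lin.
  by apply: eq_tlift => h1 h2; apply: eq_tlift => u v; rewrite mulrA.
by rewrite (counitl_lift Hs (f := fun h3 => sw (fun u v => F (S u) (S h3 * v)) L)) //; lin.
Qed.

Lemma casimir1 (U : lmodType K) (f : H -> U) : linear f ->
  sw (fun x y => f (S x * y)) L = f 1.
Proof. by move=> lf; rewrite antipodel_lift // integral_norm scale1r. Qed.

Let b := vbasis {:H}.
Let cf (j : 'I_(\dim {:H})) : {scalar H} := coord b j.

Let coordE h : \sum_j cf j h *: b`_j = h.
Proof. by rewrite [RHS](coord_vbasis (memvf h)). Qed.

(** The trace of right multiplication by h. Its left-hand counterpart [tr'] serves as an auxiliary
    and is shown to be the same form. *)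
Definition regular_trace (h : H) : K := \sum_j coord b j (b`_j * h).
Local Notation tr := regular_trace.
Let tr' (h : H) : K := \sum_j cf j (h * b`_j).

Lemma regular_trace_linear : linear (tr : H -> K^o).
Proof.
have -> : (tr : H -> K^o) = fun h => \sum_j (cf j (b`_j * h) : K^o) by [].
lin.
Qed.

Let tr'_lin : linear (tr' : H -> K^o).
Proof. rewrite /tr'; lin. Qed.

Let tlift_sum (V U : lmodType K) (W : vectType K) (I : finType) (F : I -> V -> W -> U)
    (t : tensor V W) :
  tlift (fun x y => \sum_j F j x y) t = \sum_j tlift (F j) t.
Proof. exact: exchange_big. Qed.

(** Moving b_j across the Casimir element turns the sum over the basis into sum S(L_1) L_2 = 1. This
    is what makes S(L_1) and L_2 dual bases for the trace. *)
Let trace_casimirr0 : sw (fun x y => tr y *: S x) L = 1.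
Proof.
transitivity (\sum_j sw (fun x y => cf j (b`_j * y) *: S x) L).
  by rewrite -tlift_sum; apply: eq_tlift => x y; rewrite -scaler_suml.
transitivity (sw (fun x y => S x * y) L); last exact: (@casimir1 _ id (@lin_id _ _)).
transitivity (sw (fun x y => \sum_j cf j y *: (S x * b`_j)) L); last first.
  apply: eq_tlift => x y; rewrite -[in RHS](coordE y) mulr_sumr.
  by apply: eq_bigr => j _; rewrite scalerAr.
rewrite tlift_sum; apply: eq_bigr => j _; symmetry.
by rewrite (@casimirr _ (fun u v => cf j v *: u)) //; split=> ?; lin.
Qed.

Let trace_casimirl0 : sw (fun x y => tr' (S x) *: y) L = 1.
Proof.
transitivity (\sum_j sw (fun x y => cf j (S x * b`_j) *: y) L).
  by rewrite -tlift_sum; apply: eq_tlift => x y; rewrite -scaler_suml.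
transitivity (sw (fun x y => S x * y) L); last exact: (@casimir1 _ id (@lin_id _ _)).
transitivity (sw (fun x y => \sum_j cf j (S x) *: (b`_j * y)) L); last first.
  apply: eq_tlift => x y; rewrite -[in RHS](coordE (S x)) mulr_suml.
  by apply: eq_bigr => j _; rewrite scalerAl.
rewrite tlift_sum; apply: eq_bigr => j _.
by rewrite (@casimirr _ (fun u v => cf j u *: v)) //; split=> ?; lin.
Qed.

Lemma trace_casimirr h : sw (fun x y => tr (y * h) *: S x) L = h.
Proof.
have lt := regular_trace_linear.
transitivity (sw (fun x y => tr y *: (h * S x)) L).
  by symmetry; apply: (@casimirl _ (fun u v => (tr v : K^o) *: u)); split=> ?; lin.
have l : linear (fun w => h * w) by lin.
transitivity (h * sw (fun x y => tr y *: S x) L); last by rewrite trace_casimirr0 mulr1.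
by rewrite (tlift_comp _ _ l); apply: eq_tlift => x y; rewrite scalerAr.
Qed.

Let trace_casimirl1 h : sw (fun x y => tr' (h * S x) *: y) L = h.
Proof.
have lt := tr'_lin.
transitivity (sw (fun x y => tr' (S x) *: (y * h)) L).
  by apply: (@casimirl _ (fun u v => (tr' u : K^o) *: v)); split=> ?; lin.
have l : linear (fun w => w * h) by lin.
transitivity (sw (fun x y => tr' (S x) *: y) L * h); last by rewrite trace_casimirl0 mul1r.
by rewrite (tlift_comp _ _ l); apply: eq_tlift => x y; rewrite scalerAl.
Qed.

(** Apply tr to h = sum tr'(h S(L_1)) L_2, and tr' to h = sum tr(L_2) h S(L_1): both give sum tr'(h
    S(L_1)) tr(L_2). *)
Let tr'E h : tr' h = tr h.
Proof.
have lt := regular_trace_linear; have lt' := tr'_lin.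
rewrite -[in RHS](trace_casimirl1 h).
transitivity (sw (fun x y => tr' (h * S x) *: (tr y : K^o)) L); last first.
  rewrite (tlift_comp _ _ lt); apply: (@eq_tlift _ _ _ (K^o : lmodType K)) => x y.
  by rewrite (linZ lt).
rewrite -{1}(mulr1 h) -trace_casimirr0.
have l : linear (fun w => tr' (h * w) : K^o) := lin_comp lt' (@lin_mull _ _ h).
rewrite (tlift_comp _ _ l); apply: (@eq_tlift _ _ _ (K^o : lmodType K)) => x y.
by rewrite (linZ l); exact: mulrC.
Qed.

Lemma trace_casimirl h : sw (fun x y => tr (h * S x) *: y) L = h.
Proof.
by rewrite -[RHS]trace_casimirl1; apply: eq_tlift => x y; rewrite tr'E.
Qed.

(** Let u(h) be the difference of the two sides. Since sum tr(L_2) L_1 = 1, coassociativity gives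
    sum L_1 (x) u(L_2) = Delta(1) - 1 (x) 1 = 0. As h = sum tr(h S(L_1)) L_2, applying u gives u(h)
    = 0. *)
Lemma trace_integral h : sw (fun x y => tr y *: x) h = tr h *: 1.
Proof.
have lt := regular_trace_linear.
pose u h := sw (fun x y => (tr y : K^o) *: x) h - (tr h : K^o) *: 1.
have lu : linear u by rewrite /u; lin.
suff u0 : u h = 0 by apply/eqP; rewrite -subr_eq0; apply/eqP.
have L1 : sw (fun x y => (tr y : K^o) *: x) L = 1.
  have lS : linear S by lin.
  rewrite -[RHS](antipode1 Hs) -trace_casimirr0 (tlift_comp _ _ lS).
  by apply: eq_tlift => x y; rewrite (linZ lS) S2.
have uL : sw (fun x y => tens x (u y)) L = 0.
  transitivity (sw (fun x y => sw (fun y1 y2 => (tr y2 : K^o) *: tens x y1) y) L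
     - sw (fun x y => (tr y : K^o) *: tens x (1 : H)) L).
    rewrite -sumrB; apply: eq_bigr => i _; rewrite /u.
    have l : linear (fun w : H => tens (coprod Hs L i) w) by lin.
    rewrite (linD l) -scaleN1r (linZ l) scaleN1r (tlift_comp _ _ l) (linZ l).
    by congr (_ - _); apply: eq_tlift => x y; rewrite (linZ l).
  rewrite (coassoc_lift Hs (F := fun x y z => (tr z : K^o) *: tens x y));
  try by move=> *; lin.
  have l : linear (fun w : H => coprod Hs w) by lin.
  have lid : linear (fun w : tensor H H => tlift (@tens K H H) w).
    by apply: tlift_linear => w; lin.
  have tid (t : tensor H H) : tlift (@tens K H H) t = t.
    by rewrite [RHS]tensor_decomp.
  rewrite (_ : tlift _ _ = coprod Hs (sw (fun x y => (tr y : K^o) *: x) L)); last first.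
    rewrite (tlift_comp _ _ l); apply: eq_tlift => x y.
    rewrite (linZ l) -[coprod Hs x in RHS]tid -(tlift_comp _ _ (@lin_scaler _ _ (tr y))) //.
  rewrite (_ : tlift _ (coprod Hs L) = tens (sw (fun x y => (tr y : K^o) *: x) L) 1); last first.
    have l1 : linear (fun w : H => tens w (1 : H)) by lin.
    by rewrite (tlift_comp _ _ l1); apply: eq_tlift => x y; rewrite (linZ l1).
  by rewrite L1 coprod1 subrr.
rewrite -(trace_casimirl h) (tlift_comp _ _ lu).
have lG : linear (tlift (fun p q : H => (tr (h * S p) : K^o) *: q)).
  by apply: tlift_linear => w; lin.
have := congr1 (tlift (fun p q : H => (tr (h * S p) : K^o) *: q)) uL.
rewrite (lin0 lG) (tlift_comp _ _ lG) => E; rewrite -[RHS]E.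
apply: eq_tlift => x y; rewrite tlift_tens ?(linZ lu) //.
by split=> ?; lin.
Qed.

End Integral.

(** * The idempotents e_i: e_0 is an integral and their sum is full *)

Section BasicIdempotents.
Variables (K : fieldType) (H : falgType K) (Hs : hopf_structure H).
Variables (n : nat) (e : 'I_n.+1 -> H).
Hypothesis eP : basic_idempotents Hs e.

Lemma basic_idempotent_neq0 i : e i != 0.
Proof.
have [_ [V [irrV _ _ _ isoV]]] := eP.
have [f [_ f_surj]] := isoV i; have [[v v_neq0] _] := irrV i.
apply: contraNneq v_neq0 => ei0; have [h <-] := f_surj v.
by rewrite ei0 mulr0 raddf0.
Qed.

Lemma basic_idempotent_idem i : e i * e i = e i.
Proof. by rewrite eP.1 eqxx. Qed.

(** The isomorphism of H e_0 with the trivial module is injective and kills (h - eps(h)) e_0. *)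
Lemma basic_idempotent_integral h : h * e ord0 = counit Hs h *: e ord0.
Proof.
have [_ [V [_ _ _ trivV isoV]]] := eP; have [f [f_inj _]] := isoV ord0.
apply/eqP; rewrite -subr_eq0 -mulr_algl -mulrBl; apply/eqP; apply: f_inj.
have fZ (k : H) : f (k * e ord0) = k *: f (e ord0) by rewrite -linearZ.
by rewrite fZ scalerBl trivV subrr.
Qed.

Lemma basic_idempotent_counit : counit Hs (e ord0) = 1.
Proof.
have := basic_idempotent_idem ord0; rewrite basic_idempotent_integral.
rewrite -[X in _ = X]scale1r => /eqP; rewrite -subr_eq0 -scalerBl scaler_eq0.
by rewrite (negPf (basic_idempotent_neq0 _)) orbF subr_eq0 => /eqP.
Qed.

(* Otherwise H e H lies in a maximal left ideal L, and the simple module H / L,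
   which is isomorphic to some H e_i, is killed by e_i. *)
Lemma basic_idempotents_full :
  exists s : seq (H * H), \sum_(y <- s) y.1 * (\sum_i e i) * y.2 = 1.
Proof.
set E := \sum_i e i.
pose B : seq H := vbasis {:H}.
pose pairs := [seq (x, y) | x <- B, y <- B].
pose X := [seq y.1 * E * y.2 | y <- pairs].
have XP u v : u * E * v \in <<X>>%VS.
  rewrite (coord_vbasis (memvf u)) (coord_vbasis (memvf v)).
  rewrite !mulr_suml memv_suml // => i _; rewrite mulr_sumr memv_suml // => j _.
  rewrite -scalerAr -!scalerAl !memvZ // memv_span //.
  apply/mapP; exists (B`_i, B`_j) => //.
  by apply: allpairs_f; rewrite mem_nth ?size_tuple.
case: (boolP (1 \in <<X>>%VS)) => [oneX|oneX].
  exists [seq (coord (in_tuple X) i 1 *: (nth (0, 0) pairs i).1,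
               (nth (0, 0) pairs i).2) | i <- enum 'I_(size X)].
  rewrite big_map big_enum [RHS](coord_span (X := in_tuple X) oneX).
  apply: eq_bigr => i _; rewrite /= -!scalerAl /X (nth_map (0, 0)) //.
  by rewrite -(size_map (fun y => y.1 * E * y.2) pairs).
have X_ideal h v : v \in <<X>>%VS -> h * v \in <<X>>%VS.
  move=> vX; rewrite (coord_span (X := in_tuple X) vX) mulr_sumr memv_suml // => i _.
  rewrite -scalerAr memvZ // /= /X (nth_map (0, 0)) ?mulrA //.
  by rewrite -(size_map (fun y => y.1 * E * y.2) pairs).
pose good (L : {vspace H}) :=
  [/\ forall h v, v \in L -> h * v \in L, 1 \notin L & (<<X>> <= L)%VS].
(* A proper left ideal containing H E H of largest dimension is maximal; finite dimension replaces
   Zorn's lemma. *)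
pose dims d := `[< exists2 L, good L & \dim L = d >].
have dims_ex : exists d, dims d by exists (\dim <<X>>); apply/asboolP; exists <<X>>%VS.
have dims_ub d : dims d -> (d <= \dim {:H})%N.
  by move=> /asboolP[L _ <-]; rewrite dimvS // subvf.
have [d /asboolP[L [L_ideal oneL XL] dimL] d_max] := ex_maxnP dims_ex dims_ub.
have subL r (u v : H^o) : u \in L -> v \in L -> r *: u + v \in L.
  by move=> uL vL; rewrite memvD // L_ideal.
pose W := @Submodule H H^o (fun x => x \in L) (mem0v L) subL.
have irrQ : irreducible_module (quotient_module W).
  split=> [|Z Z0 Zlin].
    exists (quot_class W 1); apply/eqP => /quot_class_eq0 /= oneL'.
    by rewrite oneL' in oneL.
  have [[x Zx x_neq0]|Zno] := pselect (exists2 x, Z x & x != 0); [right|left].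
    have [y yx] := quot_class_surj x.
    have ZZ h q : Z q -> Z (h *: q).
      by move=> Zq; rewrite -[_ *: _]addr0; apply: Zlin.
    suff Z1 : Z (quot_class W 1).
      rewrite predeqE => q; split=> // _; have [v <-] := quot_class_surj q.
      have -> : quot_class W v = v *: quot_class W 1.
        by rewrite -linearZ; congr quot_class; rewrite /GRing.scale /= mulr1.
      exact: ZZ.
    have yL : y \notin L.
      apply: contraNN x_neq0 => yL; apply/eqP; rewrite -yx.
      by apply/quot_class_eq0.
    have yy : y \in (fullv * <[y]>)%VS.
      by rewrite -[y in y \in _]mul1r memv_mul ?memvf ?memv_line.
    case: (boolP (1 \in (L + fullv * <[y]>)%VS)) => [|one_notin].
      move=> /memv_addP[l lL [_ /memv_cosetP[h _ ->] one_eq]].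
      rewrite (_ : quot_class W 1 = h *: x); first exact: ZZ.
      rewrite -yx -linearZ; apply/quot_class_eq => /=.
      by rewrite one_eq [X in _ - X]/(h * y) addrK.
    have /d_max : dims (\dim (L + fullv * <[y]>)).
      apply/asboolP; exists (L + fullv * <[y]>)%VS => //; split=> //.
        move=> h v /memv_addP[l lL [_ /memv_cosetP[k _ ->] ->]].
        by rewrite mulrDr mulrA memv_add ?L_ideal // memv_mul ?memvf ?memv_line.
      by apply: subv_trans XL _; exact: addvSl.
    rewrite -dimL leqNgt => /negP[].
    rewrite ltn_neqAle dimvS ?addvSl // andbT.
    rewrite (dimv_leqif_eq (addvSl _ _)).2; apply: contraNneq yL => ->.
    by rewrite -[y in y \in _]add0r memv_add ?mem0v.
  rewrite predeqE => q; split=> [Zq|->//]; apply/eqP; apply: contra_notT Zno => q0.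
  by exists q.
have [_ [V [_ _ allV _ isoV]]] := eP.
have [i [g g_bij]] := allV _ irrQ; have [f [f_inj _]] := isoV i.
have [x gx] : exists x, g x = f (e i) by have [g' _ gK] := g_bij; exists (g' (f (e i))).
suff fe0 : f (e i) = 0.
  have := f_inj 1; rewrite mul1r => /(_ fe0) ei0.
  by have := basic_idempotent_neq0 i; rewrite ei0 eqxx.
have fee : f (e i) = e i *: f (e i).
  by rewrite -linearZ; congr (f _); rewrite [RHS]basic_idempotent_idem.
rewrite fee -gx -linearZ; have [v <-] := quot_class_surj x.
rewrite -linearZ -(raddf0 g); congr (g _); apply/quot_class_eq0 => /=.
have eE : e i = e i * E.
  rewrite /E mulr_sumr (bigD1 i) //= basic_idempotent_idem big1 ?addr0 // => j ji.
  by rewrite eP.1 eq_sym (negPf ji).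
by apply: (subvP XL); rewrite -[_ *: _]/(e i * v) eE.
Qed.

End BasicIdempotents.

(** * The Frobenius extension A < A # H *)

Section SmashBasics.
Variables (K : fieldType) (H : falgType K) (Hs : hopf_structure H).
Variables (A : algType K) (G : connected_grading A) (M : hopf_action Hs G).
Local Notation B := (smash M).
Local Notation iA := (smashA M).
Local Notation iH := (smashH M).

Lemma smashA_linear : linear (iA : A -> B).
Proof. exact: lin_tensl. Qed.
Lemma smashH_linear : linear (iH : H -> B).
Proof. exact: lin_tensr. Qed.

Lemma smash_tensE a h : (tens a h : B) = iA a * iH h.
Proof.
rewrite -[RHS]/(smash_mul (tens a 1 : B) (tens 1 h : B)) smash_mul_tens coprod1.
rewrite tlift_tens; first by rewrite act1 mulr1 mul1r.
by split=> ?; lin.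
Qed.

Lemma smashA1 : iA 1 = 1. Proof. by []. Qed.
Lemma smashH1 : iH 1 = 1. Proof. by []. Qed.

Lemma smashAM a b : iA (a * b) = iA a * iA b.
Proof.
rewrite -[RHS]/(smash_mul (tens a 1 : B) (tens b 1 : B)) smash_mul_tens coprod1.
rewrite tlift_tens; first by rewrite act1 mulr1.
by split=> ?; lin.
Qed.

Lemma smashHA h a :
  iH h * iA a = tlift (fun x y => iA (M x a) * iH y) (coprod Hs h).
Proof.
rewrite -[LHS]/(smash_mul (tens 1 h : B) (tens a 1 : B)) smash_mul_tens.
by apply: eq_tlift => x y; rewrite mul1r mulr1 smash_tensE.
Qed.

Lemma smashHM g h : iH (g * h) = iH g * iH h.
Proof.
rewrite -[RHS]/(smash_mul (tens 1 g : B) (tens 1 h : B)) smash_mul_tens.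
have l : linear (fun w : H => iH (w * h)) by have lH := smashH_linear; lin.
rewrite -(counitl_lift Hs g l); apply: eq_tlift => x y.
by rewrite mul1r act_one (linZ (@lin_tensl _ _ _ _)).
Qed.

Lemma smash_ext (U : lmodType K) (f g : B -> U) : linear f -> linear g ->
  (forall a h, f (iA a * iH h) = g (iA a * iH h)) -> f =1 g.
Proof. by move=> lf lg fg; apply: tensor_ext => // a h; rewrite smash_tensE. Qed.

Lemma smash_decomp (x : B) :
  x = \sum_i iA ((x : tensor A H) i) * iH (vbasis {:H})`_i.
Proof. by rewrite {1}[x]tensor_decomp; apply: eq_bigr => i _; exact: smash_tensE. Qed.

End SmashBasics.

(** * The Frobenius form, its dual bases and the lifting of A-linear maps *)

Section SmashFrobenius.
Variables (K : fieldType) (H : falgType K) (Hs : hopf_structure H).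
Variables (A : algType K) (G : connected_grading A) (M : hopf_action Hs G).
Local Notation B := (smash M).
Local Notation iA := (smashA M).
Local Notation iH := (smashH M).
Local Notation S := (antipode Hs).
Local Notation eps := (counit Hs).
Local Notation sw F h := (tlift F (coprod Hs h)).
Local Notation tr := (@regular_trace K H).
Let lA := smashA_linear M.
Let lH := smashH_linear M.

Lemma smash_act a h : iA (M h a) = sw (fun x y => iH x * iA a * iH (S y)) h.
Proof.
transitivity (sw (fun x z => sw (fun y w => iA (M x a) * iH y * iH (S w)) z) h).
  rewrite -(counitr_lift Hs (f := fun x => iA (M x a))); last by lin.
  apply: eq_tlift => x z; rewrite -[iA (M x a) in LHS]mulr1 -(smashH1 M).
  rewrite -(antipoder_lift Hs (f := fun w => iA (M x a) * iH w)); last by lin.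
  by symmetry; apply: eq_tlift => y w; rewrite smashHM mulrA.
rewrite (coassoc_lift Hs (F := fun x y w => iA (M x a) * iH y * iH (S w)));
  try by move=> *; lin.
apply: eq_tlift => z w.
have l : linear (fun b : B => b * iH (S w)) by lin.
by rewrite smashHA (tlift_comp _ _ l).
Qed.

(** The commutation rule that moves H to the left of A; it follows from [smash_act], the action of H
    on A being conjugation inside A # H. *)
Lemma smash_antipode a h :
  sw (fun x y => iH (S x) * iA (M y a)) h = iA a * iH (S h).
Proof.
transitivity (sw (fun x y => sw (fun u v => iH (S x) * (iH u * iA a * iH (S v))) y) h).
  apply: eq_tlift => x y; have l : linear (fun b : B => iH (S x) * b) by lin.
  by rewrite smash_act (tlift_comp _ _ l).
rewrite (coassoc_lift Hs (F := fun x u v => iH (S x) * (iH u * iA a * iH (S v))));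
  try by move=> *; lin.
rewrite -(counitl_lift Hs (f := fun v => iA a * iH (S v))); last by lin.
apply: eq_tlift => z v.
rewrite -[iA a * _ in RHS]mul1r -(smashH1 M).
rewrite -(antipodel_lift Hs (f := fun w => iH w * (iA a * iH (S v)))); last by lin.
by apply: eq_tlift => x u; rewrite smashHM !mulrA.
Qed.

Hypothesis S2 : forall h, S (S h) = h.
Variable L : H.
Hypothesis integral_l : forall h, h * L = eps h *: L.
Hypothesis integral_norm : eps L = 1.

Let ltr : linear (tr : H -> K^o) := @regular_trace_linear K H.

(* The Frobenius form of the extension A < A # H. *)
Definition smash_form (x : B) : A := tlift (fun a h => tr h *: a) x.
Local Notation tau := smash_form.

Lemma smash_form_linear : linear tau.
Proof. by apply: tlift_linear => h; lin. Qed.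
Let ltau := smash_form_linear.

Lemma smash_form_tens a h : tau (iA a * iH h) = tr h *: a.
Proof.
rewrite -smash_tensE /tau tlift_tens //; split=> ?; first by lin.
exact: (lin_comp (@lin_scalel _ _ _) ltr).
Qed.

Lemma smash_form_mull a x : tau (iA a * x) = a * tau x.
Proof.
apply: (@smash_ext _ _ _ _ _ M _
  (fun x => tau (iA a * x)) (fun x => a * tau x)); [lin|lin|].
by move=> b h; rewrite mulrA -smashAM !smash_form_tens scalerAr.
Qed.

Lemma smash_form_HA h a k :
  tau (iH h * iA a * iH k) = sw (fun x y => tr (y * k) *: M x a) h.
Proof.
have l : linear (fun x => tau (x * iH k)) by lin.
rewrite smashHA (tlift_comp _ _ l); apply: eq_tlift => x y.
by rewrite -mulrA -smashHM smash_form_tens.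
Qed.

(** The case of 1 # h decides: tau(h a) = sum tr(h_2) (h_1 . a), which is tr(h) a because the trace
    is an integral of the dual of H. *)
Lemma smash_form_mulr x a : tau (x * iA a) = tau x * a.
Proof.
apply: (@smash_ext _ _ _ _ _ M _
  (fun x => tau (x * iA a)) (fun x => tau x * a)); [lin|lin|].
move=> b h; rewrite -mulrA smash_form_mull -[iH h * _]mulr1 -(smashH1 M).
rewrite smash_form_HA smash_form_tens.
transitivity (b * M (sw (fun x y => tr y *: x) h) a).
  congr (b * _); have l : linear (fun w => M w a) by lin.
  by rewrite (tlift_comp _ _ l); apply: eq_tlift => p q; rewrite (linZ l) mulr1.
have l : linear (fun w => M w a) by lin.
by rewrite (trace_integral S2 integral_l integral_norm) (linZ l) act1 -scalerAl scalerAr.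
Qed.

Lemma smash_dual_basisl (x : B) :
  sw (fun u v => iA (tau (x * iH (S u))) * iH v) L = x.
Proof.
apply: (@smash_ext _ _ _ _ _ M _
  (fun x => sw (fun u v => iA (tau (x * iH (S u))) * iH v) L) id); [lin|lin|].
move=> a h; rewrite -[in RHS](trace_casimirl S2 integral_l integral_norm h).
have l : linear (fun w => iA a * iH w) by lin.
rewrite (tlift_comp _ _ l); apply: eq_tlift => u v.
by rewrite -mulrA -smashHM smash_form_tens (linZ l) (linZ lA) scalerAl.
Qed.

(** For x = a h the sum is S(L_1) (L_2 . a) tr(L_3 h), which [smash_antipode] turns into a S(L_1)
    tr(L_2 h) = a h. Thus B is a finitely generated projective right A-module with an explicit dual
    basis. *)
Lemma smash_dual_basisr (x : B) :
  sw (fun u v => iH (S u) * iA (tau (iH v * x))) L = x.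
Proof.
apply: (@smash_ext _ _ _ _ _ M _
  (fun x => sw (fun u v => iH (S u) * iA (tau (iH v * x))) L) id); [lin|lin|].
move=> a h.
transitivity (sw (fun u v => sw (fun p q => (tr (q * h) : K^o) *: (iH (S u) * iA (M p a))) v) L).
  apply: eq_tlift => u v; have l : linear (fun w => iH (S u) * iA w) by lin.
  rewrite mulrA smash_form_HA (tlift_comp _ _ l).
  by apply: eq_tlift => p q; rewrite (linZ l).
rewrite (coassoc_lift Hs (F := fun u p q => (tr (q * h) : K^o) *: (iH (S u) * iA (M p a))));
  try by move=> *; lin.
transitivity (sw (fun u v => (tr (v * h) : K^o) *: (iA a * iH (S u))) L).
  apply: eq_tlift => u v; rewrite -smash_antipode.
  by rewrite (tlift_comp _ _ (@lin_scaler _ _ (tr (v * h)))).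
rewrite -[in RHS](trace_casimirr S2 integral_l integral_norm h).
have l : linear (fun w => iA a * iH w) by lin.
by rewrite (tlift_comp _ _ l); apply: eq_tlift => u v; rewrite (linZ l).
Qed.

Section Lift.
Variable J : set B.
Hypothesis JD : forall x y, J x -> J y -> J (x + y).
Hypothesis J0 : J 0.
Hypothesis JM : forall x y, J x -> J (x * y).
Variable phi : B -> A.
Hypothesis phiD : forall x y, J x -> J y -> phi (x + y) = phi x + phi y.
Hypothesis phiM : forall x a, J x -> phi (x * iA a) = phi x * a.

(* The A-linear map phi on the right ideal J is turned into a B-linear map. *)
Definition frobenius_lift (x : B) : B :=
  sw (fun u v => iA (phi (x * iH (S u))) * iH v) L.
Local Notation Phi := frobenius_lift.

Let phi_sum (I : Type) (s : seq I) (F : I -> B) : (forall i, J (F i)) ->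
  phi (\sum_(i <- s) F i) = \sum_(i <- s) phi (F i).
Proof.
move=> JF; suff [] : J (\sum_(i <- s) F i) /\ phi (\sum_(i <- s) F i) = \sum_(i <- s) phi (F i) by [].
elim: s => [|i s [IH1 IH2]].
  rewrite !big_nil; split=> //; apply: (addrI (phi 0)).
  by rewrite -phiD // !addr0.
by rewrite !big_cons; split; [exact: JD|rewrite phiD // IH2].
Qed.

Let phi_lin x : J x -> linear (fun h => phi (x * iH h)).
Proof.
move=> Jx c u v; rewrite lH mulrDr phiD; [|exact: JM..]; congr (_ + _).
(* Scalars lie in A, so linearity over K is a case of linearity over A. *)
have -> : x * (c *: iH u) = x * iH u * iA (c *: 1).
  by rewrite (linZ lA) smashA1 -!scalerAr mulr1.
by rewrite phiM ?scalerAr ?mulr1 -?scalerAr ?mulr1 //; exact: JM.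
Qed.

Lemma frobenius_liftD x y : J x -> J y -> Phi (x + y) = Phi x + Phi y.
Proof.
move=> Jx Jy; rewrite /Phi /tlift -big_split; apply: eq_bigr => i _ /=.
by rewrite mulrDl phiD ?(linD lA) ?mulrDl //; exact: JM.
Qed.

Let frobenius_lift_sum (x : B) (I : Type) (s : seq I) (F : I -> B) : J x ->
  Phi (x * \sum_(i <- s) F i) = \sum_(i <- s) Phi (x * F i).
Proof.
move=> Jx; elim: s => [|i s IH]; last by rewrite !big_cons mulrDr frobenius_liftD ?IH //; exact: JM.
rewrite !big_nil; apply: (addrI (Phi (x * 0))).
by rewrite -frobenius_liftD ?addr0 ?mulr0 ?addr0 //; exact: JM.
Qed.

(** Moving a across S(L_1) gives phi(x S(L_1)) (L_2 . a) L_3, and (L_2 . a) L_3 is L_2 a in B.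
    Linearity over H, proved next, is the centrality of the Casimir element. *)
Let frobenius_liftA x a : J x -> Phi (x * iA a) = Phi x * iA a.
Proof.
move=> Jx; have l := phi_lin Jx; pose psi h := phi (x * iH h).
have lpsi : linear psi by exact: l.
transitivity (sw (fun u v => sw (fun p q =>
    iA (psi (S p)) * iA (M q a) * iH v) u) L).
  apply: eq_tlift => u v; rewrite -mulrA -smash_antipode /tlift mulr_sumr phi_sum.
    rewrite (lin_sum lA) mulr_suml; apply: eq_bigr => i _.
    by rewrite mulrA phiM ?smashAM //; exact: JM.
  by move=> i; exact: JM.
rewrite -(coassoc_lift Hs (F := fun p q v => iA (psi (S p)) * iA (M q a) * iH v));
  try by move=> *; lin.
have lm : linear (fun w : B => w * iA a) by lin.
rewrite /Phi (tlift_comp _ _ lm); apply: eq_tlift => p z.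
have l2 : linear (fun w => iA (psi (S p)) * w) by lin.
rewrite -mulrA smashHA (tlift_comp _ _ l2); apply: eq_tlift => q v.
by rewrite mulrA.
Qed.

Let frobenius_liftH x h : J x -> Phi (x * iH h) = Phi x * iH h.
Proof.
move=> Jx; pose psi h := phi (x * iH h); have lpsi : linear psi := phi_lin Jx.
transitivity (sw (fun u v => iA (psi (h * S u)) * iH v) L).
  by apply: eq_tlift => u v; rewrite -mulrA -smashHM.
rewrite (casimirl S2 integral_l integral_norm (F := fun u v => iA (psi u) * iH v)); last by split=> ?; lin.
have lm : linear (fun w : B => w * iH h) by lin.
rewrite /Phi (tlift_comp _ _ lm); apply: eq_tlift => u v.
by rewrite smashHM mulrA.
Qed.

Lemma frobenius_liftM x y : J x -> Phi (x * y) = Phi x * y.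
Proof.
move=> Jx; rewrite [y]smash_decomp frobenius_lift_sum // mulr_sumr.
apply: eq_bigr => i _; rewrite !mulrA frobenius_liftH ?frobenius_liftA //.
exact: JM.
Qed.

(** The lift loses nothing: tau recovers phi, since sum tr(L_2) S(L_1) = 1. *)
Lemma smash_form_lift x : J x -> tau (Phi x) = phi x.
Proof.
move=> Jx; pose psi h := phi (x * iH h); have lpsi : linear psi := phi_lin Jx.
rewrite /Phi (tlift_comp _ _ ltau).
transitivity (psi 1); last by rewrite /psi smashH1 mulr1.
rewrite -[in RHS](trace_casimirr S2 integral_l integral_norm 1) (tlift_comp _ _ lpsi).
by apply: eq_tlift => u v; rewrite smash_form_tens mulr1 (linZ lpsi).
Qed.

End Lift.

End SmashFrobenius.

(** * The Auslander map and the trace ideal *)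

Section AuslanderIdeal.
Variables (K : fieldType) (H : falgType K) (Hs : hopf_structure H).
Variables (A : algType K) (G : connected_grading A) (M : hopf_action Hs G).
Local Notation B := (smash M).
Local Notation iA := (smashA M).
Local Notation iH := (smashH M).
Local Notation eps := (counit Hs).
Let lA := smashA_linear M.
Let lH := smashH_linear M.
Variable L : H.

Definition trace_ideal : set B :=
  [set x | exists s : seq (B * B), x = \sum_(y <- s) y.1 * iH L * y.2].
Local Notation I := trace_ideal.

Lemma trace_ideal0 : I 0. Proof. by exists [::]; rewrite big_nil. Qed.
Lemma trace_idealD x y : I x -> I y -> I (x + y).
Proof. by move=> [s ->] [t ->]; exists (s ++ t); rewrite big_cat. Qed.
Lemma trace_idealMr x y : I x -> I (x * y).
Proof.
move=> [s ->]; exists [seq (z.1, z.2 * y) | z <- s].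
by rewrite big_map mulr_suml; apply: eq_bigr => z _; rewrite !mulrA.
Qed.
Lemma trace_idealMl x y : I x -> I (y * x).
Proof.
move=> [s ->]; exists [seq (y * z.1, z.2) | z <- s].
by rewrite big_map mulr_sumr; apply: eq_bigr => z _; rewrite !mulrA.
Qed.
Lemma trace_idealN x : I x -> I (- x).
Proof. by rewrite -mulN1r; exact: trace_idealMl. Qed.
Lemma trace_idealB x y : I x -> I y -> I (x - y).
Proof. by move=> Ix Iy; apply: trace_idealD => //; exact: trace_idealN. Qed.
Lemma trace_ideal_gen x y : I (x * iH L * y).
Proof. by exists [:: (x, y)]; rewrite big_seq1. Qed.

(* Hom_B(B / I, B) = 0 and Ext^1_B(B / I, B) = 0 for right B-modules. *)
Definition ideal_faithful : Prop :=
  forall b : B, (forall x, I x -> b * x = 0) -> b = 0.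
Definition ideal_hom_inner : Prop := forall f : B -> B,
  (forall x y, I x -> I y -> f (x + y) = f x + f y) ->
  (forall x y, I x -> f (x * y) = f x * y) ->
  exists b, forall x, I x -> f x = b * x.

Hypothesis integral_l : forall h, h * L = eps h *: L.
Hypothesis integral_norm : eps L = 1.

Lemma smashHA_integral h a : iH h * iA a * iH L = iA (M h a) * iH L.
Proof.
have l : linear (fun w : B => w * iH L) by lin.
rewrite smashHA (tlift_comp _ _ l) -(counitr_lift Hs (f := fun w => iA (M w a) * iH L)); last by lin.
apply: eq_tlift => x y.
by rewrite -mulrA -smashHM integral_l (linZ lH) scalerAr.
Qed.

(** The map a |-> a L identifies A with the left ideal B L, injectively by [smash_integral_inj];
    under it B acts on A through the Auslander map. *)
Lemma smash_auslander (x : B) a : x * iA a * iH L = iA (auslander x a) * iH L.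
Proof.
have la := @auslander_linear K H Hs A G M a.
apply: (@smash_ext _ _ _ _ _ M _
  (fun x => x * iA a * iH L) (fun x => iA (auslander x a) * iH L)).
- lin.
- by apply: (lin_comp (@lin_mulr _ _ (iH L))); apply: (lin_comp lA).
move=> b h; rewrite -smash_tensE auslander_tens smashAM smash_tensE.
by rewrite -!mulrA; congr (_ * _); rewrite mulrA smashHA_integral.
Qed.

Lemma smash_auslander1 (x : B) : x * iH L = iA (auslander x 1) * iH L.
Proof. by rewrite -smash_auslander smashA1 mulr1. Qed.

Lemma smash_integral_inj a b : iA a * iH L = iA b * iH L -> a = b.
Proof.
move=> /(congr1 (fun x : B => auslander x 1)).
rewrite -!smash_tensE !auslander_tens !act_one integral_norm.
by rewrite -[1%:A]/(1 *: 1 : A) scale1r !mulr1.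
Qed.

Lemma integral_invariant a : invariants M (M L a).
Proof.
by move=> h; rewrite -actM integral_l (linZ ((act_bilinear M).2 a)).
Qed.

Lemma integral_sandwich y : iH L * y * iH L = iA (M L (auslander y 1)) * iH L.
Proof. by rewrite -mulrA smash_auslander1 mulrA smashHA_integral. Qed.

Lemma integral_invariant_act b : invariants M b -> M L b = b.
Proof. by move=> ->; rewrite integral_norm scale1r. Qed.

Lemma auslander_inj_faithful :
  ideal_faithful <-> (forall b : B, auslander b = (fun=> 0) -> b = 0).
Proof.
split=> [faith b b0|inj b bI].
  apply: faith => x [s ->]; rewrite mulr_sumr big1 // => y _.
  rewrite smash_auslander1 !mulrA smash_auslander b0.
  by rewrite (lin0 lA) !mul0r.
apply: inj; apply: funext => a; apply: smash_integral_inj.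
rewrite -smash_auslander (lin0 lA) mul0r -mulrA bI //.
by rewrite -[X in I X]mulr1; exact: trace_ideal_gen.
Qed.

(** Transported to B L, the map g extends to I = B L B by sum x L y |-> sum g(x L) y. Once this is
    well defined, it is right B-linear, hence left multiplication by some b, and b acts on A as
    g. *)
Lemma auslander_surj (faith : ideal_faithful) (inner : ideal_hom_inner) g :
  End_invariants M g -> exists b : B, auslander b = g.
Proof.
move=> [gD gM].
have g0 : g 0 = 0 by apply: (addrI (g 0)); rewrite -gD !addr0.
pose img (s : seq (B * B)) : B :=
  \sum_(y <- s) iA (g (auslander y.1 1)) * iH L * y.2.
pose dom (s : seq (B * B)) : B := \sum_(y <- s) y.1 * iH L * y.2.
(* Since L y L lies in A^H L, the A^H-linearity of g shows that img(s) z L depends only on dom(s) z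
   L. So img(s) annihilates I when dom(s) = 0, and faithfulness gives img(s) = 0. *)
have img_unit s z : img s * z * iH L =
    iA (g (\sum_(y <- s) auslander y.1 1 * M L (auslander (y.2 * z) 1))) * iH L.
  rewrite /img (big_morph g gD g0) (lin_sum lA) !mulr_suml; apply: eq_bigr => y _.
  rewrite gM; last exact: integral_invariant.
  by rewrite smashAM -[RHS]mulrA -integral_sandwich !mulrA.
have dom_unit s z : dom s * z * iH L =
    iA (\sum_(y <- s) auslander y.1 1 * M L (auslander (y.2 * z) 1)) * iH L.
  rewrite /dom (lin_sum lA) !mulr_suml; apply: eq_bigr => y _.
  by rewrite smashAM -[RHS]mulrA -integral_sandwich !mulrA -smash_auslander1.
have img0 s : dom s = 0 -> img s = 0.
  move=> s0; apply: faith => x [t ->]; rewrite mulr_sumr big1 // => y _.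
  rewrite !mulrA img_unit; set w := \sum_(_ <- _) _.
  suff -> : w = 0 by rewrite g0 (lin0 lA) !mul0r.
  by apply: smash_integral_inj; rewrite -dom_unit s0 (lin0 lA) !mul0r.
have img_eq s t : dom s = dom t -> img s = img t.
  move=> st; pose t' := [seq (y.1, - y.2) | y <- t].
  have dt : dom t' = - dom t.
    by rewrite /dom big_map -sumrN; apply: eq_bigr => y _; rewrite mulrN.
  have it : img t' = - img t.
    by rewrite /img big_map -sumrN; apply: eq_bigr => y _; rewrite mulrN.
  have dst : dom (s ++ t') = dom s + dom t' by rewrite /dom big_cat.
  have ist : img (s ++ t') = img s + img t' by rewrite /img big_cat.
  have /img0 : dom (s ++ t') = 0 by rewrite dst dt st; exact: addrN.
  by rewrite ist it => /eqP; rewrite addr_eq0 opprK => /eqP.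
(* Outside I the value is the default 0; only the values on I are constrained. *)
pose f x := xget 0 [set r | exists2 s, x = dom s & r = img s].
have fE s : f (dom s) = img s.
  rewrite /f; case: xgetP => [r _ [t st ->]|/(_ (img s))[]]; last by exists s.
  exact: img_eq.
have [x y [s ->] [t ->]|x y [s ->]|b bE] := inner f.
- have -> : \sum_(y <- s) y.1 * iH L * y.2 + \sum_(y <- t) y.1 * iH L * y.2 = dom (s ++ t).
    by rewrite /dom big_cat.
  by rewrite !fE /img big_cat.
- have -> : (\sum_(y <- s) y.1 * iH L * y.2) * y = dom [seq (z.1, z.2 * y) | z <- s].
    by rewrite /dom big_map mulr_suml; apply: eq_bigr => z _; rewrite !mulrA.
  by rewrite !fE /img big_map mulr_suml; apply: eq_bigr => z _; rewrite !mulrA.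
exists b; apply: funext => a; apply: smash_integral_inj; rewrite -smash_auslander.
have -> : b * iA a * iH L = b * dom [:: (iA a, 1)].
  by rewrite /dom big_seq1 /= mulr1 mulrA.
rewrite -bE; last by exists [:: (iA a, 1)].
rewrite fE /img big_seq1 /= mulr1; congr (iA (g _) * _).
by apply: smash_integral_inj; rewrite -smash_auslander1.
Qed.

(** As L is idempotent, f(a L) = f(a L) L lies in B L, so f induces an A^H-linear endomorphism of A.
    If b realizes it, then f is multiplication by b on A L, hence on I = A L B. *)
Lemma auslander_hom_inner : L * L = L ->
  (forall g, End_invariants M g -> exists b : B, auslander b = g) ->
  ideal_hom_inner.
Proof.
move=> idemL surj f fD fM.
have IA a : I (iA a * iH L) by rewrite -[_ * _]mulr1; exact: trace_ideal_gen.
have EE : iH L * iH L = iH L by rewrite -smashHM idemL.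
have fA a : f (iA a * iH L) = iA (auslander (f (iA a * iH L)) 1) * iH L.
  by rewrite -smash_auslander1 -fM // -mulrA EE.
have [b bE] : exists b : B, auslander b = fun a => auslander (f (iA a * iH L)) 1.
  apply: surj; split=> [a c|a c inv_c]; apply: smash_integral_inj.
    by rewrite -fA (linD lA) mulrDl fD // (linD lA) mulrDl -!fA.
  have cE : iA c * iH L = iH L * iA c * iH L.
    by rewrite smashHA_integral integral_invariant_act.
  rewrite -fA !smashAM -!mulrA cE !mulrA -fA -!(mulrA (iA a * iH L)) fM //.
  by rewrite !mulrA.
exists b; have fb a : f (iA a * iH L) = b * (iA a * iH L).
  by rewrite fA mulrA smash_auslander bE.
have f0 : f 0 = 0 by rewrite -(mul0r (iH L)) -(lin0 lA) fb (lin0 lA) mul0r mulr0.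
move=> x [s ->]; elim: s => [|y s IH]; first by rewrite big_nil f0 mulr0.
rewrite big_cons fD; [|exact: trace_ideal_gen|by exists s].
by rewrite IH mulrDr smash_auslander1 fM // fb !mulrA.
Qed.

Lemma auslander_isoE : L * L = L ->
  auslander_iso M <-> ideal_faithful /\ ideal_hom_inner.
Proof.
move=> idemL; split=> [[_ inj surj]|[faith inner]].
  split.
    apply/auslander_inj_faithful => b b0; apply: inj; rewrite ?inE // b0.
    by apply: funext => a; rewrite (lin0 (@auslander_linear _ _ _ _ _ M a)).
  apply: auslander_hom_inner => // g /surj[b _ bg]; by exists b.
split=> [x _|x y _ _ xy|g /(auslander_surj faith inner)[b bg]].
- exact: auslander_End.
- apply/eqP; rewrite -subr_eq0; apply/eqP.
  apply: (auslander_inj_faithful.1 faith); apply: funext => a.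
  have la := @auslander_linear K H Hs A G M a.
  by rewrite (linD la) -scaleN1r (linZ la) scaleN1r xy subrr.
by exists b.
Qed.

End AuslanderIdeal.

(** * The right A-module B/I as a left module over the converse algebra *)

Section RightRegularModule.
Variables (K : fieldType) (H : falgType K) (Hs : hopf_structure H).
Variables (A : algType K) (G : connected_grading A) (M : hopf_action Hs G).
Local Notation B := (smash M).
Local Notation iA := (smashA M).
Local Notation iH := (smashH M).

Definition smash_right : Type := smash M.
HB.instance Definition _ := GRing.Zmodule.copy smash_right (smash M).

Let sc (a : A^c) (x : smash_right) : smash_right := (x : B) * iA a.

Fact smash_right_scA a b x : sc a (sc b x) = sc (a * b) x.
Proof. by rewrite /sc -mulrA -smashAM. Qed.
Fact smash_right_sc1 : left_id 1 sc.
Proof. by move=> x; rewrite /sc smashA1 mulr1. Qed.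
Fact smash_right_scDr : right_distributive sc +%R.
Proof. by move=> a x y; exact: mulrDl. Qed.
Fact smash_right_scDl x : {morph sc^~ x : a b / a + b}.
Proof. by move=> a b; rewrite /sc (linD (smashA_linear M)) mulrDr. Qed.
HB.instance Definition _ := GRing.Zmodule_isLmodule.Build A^c smash_right
  smash_right_scA smash_right_sc1 smash_right_scDr smash_right_scDl.

Lemma smash_right_scaleE (a : A^c) (x : smash_right) : a *: x = (x : B) * iA a.
Proof. by []. Qed.

Variable L : H.

Fact trace_submodP r (u v : smash_right) :
  trace_ideal L (u : B) -> trace_ideal L (v : B) -> trace_ideal L (r *: u + v : B).
Proof. by move=> Iu Iv; apply: trace_idealD => //; exact: trace_idealMr. Qed.

Definition trace_submod : submodule smash_right :=
  @Submodule A^c smash_right (@trace_ideal _ _ _ _ _ M L) (trace_ideal0 M L) trace_submodP.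

Definition trace_quotient : lmodType A^c := quotient_module trace_submod.

End RightRegularModule.
Arguments trace_quotient {K H Hs A G} M L.

(** * Ext of B/I over A in degrees 0 and 1, in terms of the ideal I *)

Section TraceQuotientExt.
Variables (K : fieldType) (H : falgType K) (Hs : hopf_structure H).
Variables (A : algType K) (G : connected_grading A) (M : hopf_action Hs G).
Local Notation B := (smash M).
Local Notation iA := (smashA M).
Local Notation iH := (smashH M).
Local Notation S := (antipode Hs).
Local Notation eps := (counit Hs).
Local Notation tau := (@smash_form K H Hs A G M).
Let lA := smashA_linear M.
Let lH := smashH_linear M.
Hypothesis S2 : forall h, S (S h) = h.
Variable L : H.
Hypothesis integral_l : forall h, h * L = eps h *: L.
Hypothesis integral_norm : eps L = 1.
Local Notation I := (@trace_ideal K H Hs A G M L).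
Local Notation N := (trace_quotient M L).
Local Notation cl := (quot_class (trace_submod M L)).

Variable P : proj_resolution N.

Let projB : {beta : {linear P 0%N -> smash_right M} |
  forall p, cl (beta p) = res_eps P p}.
Proof.
apply: cid; apply: (res_projective (p := P)) => y.
exact: quot_class_surj.
Qed.
Let beta (p : P 0%N) : B := sval projB p.

Let betaE p : cl (beta p) = res_eps P p. Proof. exact: (svalP projB). Qed.
Let betaD p q : beta (p + q) = beta p + beta q. Proof. exact: raddfD. Qed.
Let betaZ (a : A^c) p : beta (a *: p) = beta p * iA a.
Proof. by rewrite /beta linearZ. Qed.

Let liftH : {l : H -> P 0%N | forall h, res_eps P (l h) = cl (iH h)}.
Proof.
have [l lE] := choice (fun h => res_eps_surj P (cl (iH h)) : exists y, res_eps P y = _).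
by exists l.
Qed.

(** An A-linear lift of B -> N to P_0, written with the dual basis of [smash_dual_basisr]. Linearity
    comes from tau alone, so [liftH] may be an arbitrary choice of preimages. *)
Let alpha (x : B) : P 0%N := \sum_(i < \dim {:H})
  (tau (iH (vbasis {:H})`_i * x) : A^c) *: sval liftH (S (coprod Hs L i)).

Let alphaD x y : alpha (x + y) = alpha x + alpha y.
Proof.
rewrite -big_split; apply: eq_bigr => i _ /=.
by rewrite mulrDr (linD (@smash_form_linear _ _ _ _ _ M)) scalerDl.
Qed.

Let alphaZ x (a : A^c) : alpha (x * iA a) = a *: alpha x.
Proof.
rewrite scaler_sumr; apply: eq_bigr => i _.
by rewrite mulrA (smash_form_mulr S2 integral_l integral_norm) scalerA.
Qed.

Let alpha0 : alpha 0 = 0.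
Proof. by apply: (addrI (alpha 0)); rewrite -alphaD !addr0. Qed.
Let alphaE x : res_eps P (alpha x) = cl x.
Proof.
rewrite /alpha raddf_sum.
transitivity (\sum_i cl (iH (S (coprod Hs L i)) * iA (tau (iH (vbasis {:H})`_i * x)))).
  by apply: eq_bigr => i _; rewrite [LHS]linearZ /= (svalP liftH) -linearZ.
rewrite -(raddf_sum cl); congr (cl _).
exact: (smash_dual_basisr S2 integral_l integral_norm).
Qed.

Let eps0P p : res_eps P p = 0 <-> I (beta p).
Proof. by rewrite -betaE; exact: quot_class_eq0. Qed.

Let beta_alpha x : I (beta (alpha x) - x).
Proof. by apply/(quot_class_eq (trace_submod M L)); rewrite betaE alphaE. Qed.

Let alpha_beta p : res_eps P (p - alpha (beta p)) = 0.
Proof.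
have -> : res_eps P (p - alpha (beta p)) = res_eps P p - res_eps P (alpha (beta p)).
  exact: raddfB.
by rewrite alphaE betaE subrr.
Qed.

Let alpha_ideal x : I x -> exists y, res_d P 0 y = alpha x.
Proof.
by move=> Ix; apply/res_exact0; rewrite alphaE; apply/quot_class_eq0.
Qed.

Let beta_d y : I (beta (res_d P 0 y)).
Proof. by apply/eps0P/res_exact0; exists y. Qed.

(** The body of [Ext_zero] for the fixed resolution P. *)
Definition vanishing (i : nat) : Prop :=
  let Q k (f : P k -> A^c^o) := linear f in
  forall f : P i -> A^c^o, cocycle Q f -> coboundary Q f.

Let tauD x y : tau (x + y) = tau x + tau y.
Proof. exact: (linD (@smash_form_linear _ _ _ _ _ M)). Qed.
Let tauMr x a : tau (x * iA a) = tau x * a.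
Proof. exact: (smash_form_mulr S2 integral_l integral_norm). Qed.

Let tau_inj (b : B) : (forall x, tau (b * x) = 0) -> b = 0.
Proof.
move=> b0; rewrite -(smash_dual_basisl S2 integral_l integral_norm b).
by rewrite /tlift big1 // => i _; rewrite b0 (lin0 lA) mul0r.
Qed.

(** If b I = 0, then p |-> tau(b beta(p)) is a 0-cocycle, hence zero. Since beta(alpha(x)) - x lies
    in I, this gives tau(b x) = 0 for all x, and tau is nondegenerate. *)
Lemma vanishing_ideal_faithful : vanishing 0 -> ideal_faithful M L.
Proof.
move=> van b bI; apply: tau_inj => x.
pose f (p : P 0%N) : A^c^o := tau (b * beta p).
have f0 : forall p, f p = 0.
  apply: (van f); split=> [a p q|y]; last first.
    by rewrite /f bI // -[tau 0]/(tau (0 : B)) (lin0 (@smash_form_linear _ _ _ _ _ M)).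
  by rewrite /f betaD betaZ mulrDr mulrA tauD tauMr.
have := f0 (alpha x); rewrite /f -[beta _](subrK x) mulrDr bI ?add0r //.
Qed.

(** Composing tau f with beta d gives a 1-cocycle. A cochain g bounding it extends tau f from I to
    all of B; the Frobenius lift of the extension is B-linear on B, so it is left multiplication by
    its value at 1. *)
Lemma vanishing_ideal_hom_inner : vanishing 1 -> ideal_hom_inner M L.
Proof.
move=> van f fD fM.
pose phi x := tau (f x).
have phiD x y : I x -> I y -> phi (x + y) = phi x + phi y.
  by move=> Ix Iy; rewrite /phi fD // tauD.
have phiM x a : I x -> phi (x * iA a) = phi x * a.
  by move=> Ix; rewrite /phi fM // tauMr.
have phi0 : phi 0 = 0.
  by apply: (addrI (phi 0)); rewrite -phiD ?addr0 //; exact: trace_ideal0.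
have phiB x y : I x -> I y -> phi (x - y) = phi x - phi y.
  move=> Ix Iy; apply/eqP; rewrite eq_sym subr_eq -phiD ?subrK //.
  exact: trace_idealB.
have [|g lg gE] := van (fun y => phi (beta (res_d P 0 y)) : A^c^o).
  split=> [a x y|x].
    by rewrite linearP betaD betaZ phiD ?phiM //; exact: trace_idealMr.
  rewrite (_ : res_d P 0 _ = 0) ?raddf0 //; last by apply/res_exactS; exists x.
  by rewrite -[beta 0]/(sval projB 0) raddf0.
have gD x y : g (x + y) = g x + g y by have := lg 1 x y; rewrite !scale1r.
have gZ (a : A^c) x : g (a *: x) = (g x : A) * a.
  have g0 : g 0 = 0 by apply: (addrI (g 0)); rewrite -gD !addr0.
  by have := lg a x 0; rewrite !addr0 g0 addr0.
(* The argument of phi lies in I for every x. For x in I, alpha(x) is a boundary, so g(alpha(x)) =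
   phi(beta(alpha(x))) and F(x) = phi(x). *)
pose F x : A := g (alpha x) - phi (beta (alpha x) - x).
have FD x y : F (x + y) = F x + F y.
  have E (V : zmodType) (a b c e : V) : a + b - (c + e) = a - c + (b - e).
    by rewrite opprD addrACA.
  rewrite /F alphaD gD betaD [X in phi X]E.
  rewrite (phiD _ _ (beta_alpha x) (beta_alpha y)).
  exact: (E A).
have FM x a : F (x * iA a) = F x * a.
  by rewrite /F alphaZ gZ betaZ -mulrBl phiM ?beta_alpha // mulrBl.
have FE x : I x -> F x = phi x.
  move=> Ix; have [y yx] := alpha_ideal Ix.
  have Ibx : I (beta (alpha x)) by rewrite -yx.
  by rewrite /F -yx -gE yx phiB // opprB addrC subrK.
pose T := [set: B].
have liftM x y : frobenius_lift L F (x * y) = frobenius_lift L F x * y.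
  by apply: (frobenius_liftM S2 integral_l integral_norm (J := T)) => //.
exists (frobenius_lift L F 1) => x Ix.
rewrite -liftM mul1r -[LHS](smash_dual_basisl S2 integral_l integral_norm).
apply: eq_tlift => u v; rewrite FE; last exact: trace_idealMr.
by rewrite /phi fM.
Qed.

(** A 0-cocycle f factors through N, so f alpha vanishes on I. Its Frobenius lift is left
    multiplication by an element that kills I, hence zero, and f is recovered from f alpha because p
    - alpha(beta(p)) maps to 0 in N. *)
Lemma ideal_faithful_vanishing : ideal_faithful M L -> vanishing 0.
Proof.
move=> faith Q f [lf fd] p /=.
have fD x y : f (x + y) = f x + f y by have := lf 1 x y; rewrite !scale1r.
have f0 : f 0 = 0 by apply: (addrI (f 0)); rewrite -fD !addr0.
have fZ (a : A^c) x : f (a *: x) = (f x : A) * a.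
  by have := lf a x 0; rewrite !addr0 f0 addr0.
have fker q : res_eps P q = 0 -> f q = 0 by move=> /res_exact0[y <-].
pose phi x : A := f (alpha x).
have phiD x y : phi (x + y) = phi x + phi y by rewrite /phi alphaD fD.
have phiM x a : phi (x * iA a) = phi x * a by rewrite /phi alphaZ fZ.
have phiI x : I x -> phi x = 0.
  by move=> Ix; apply: fker; rewrite alphaE; apply/quot_class_eq0.
pose T := [set: B].
have liftM x y : frobenius_lift L phi (x * y) = frobenius_lift L phi x * y.
  by apply: (frobenius_liftM S2 integral_l integral_norm (J := T)) => //.
have lift1 : frobenius_lift L phi 1 = 0.
  apply: faith => x Ix; rewrite -liftM mul1r /frobenius_lift /tlift big1 // => i _.
  by rewrite phiI ?(lin0 lA) ?mul0r //; exact: trace_idealMr.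
have phi0 x : phi x = 0.
  rewrite -(smash_form_lift S2 integral_l integral_norm (J := T) _ (phi := phi)) //.
  by rewrite -[x]mul1r liftM lift1 mul0r (lin0 (@smash_form_linear _ _ _ _ _ M)).
rewrite -[p](subrK (alpha (beta p))) fD fker ?alpha_beta // add0r.
exact: phi0.
Qed.

(** A 1-cocycle descends along d to a map [ft] on ker(P_0 -> N). Its pullback along alpha is defined
    on I, and the hypothesis makes it x |-> tau(b x). *)
Lemma ideal_hom_inner_vanishing : ideal_hom_inner M L -> vanishing 1.
Proof.
move=> inner Q f [lf fd] /=.
have fD x y : f (x + y) = f x + f y by have := lf 1 x y; rewrite !scale1r.
have f0 : f 0 = 0 by apply: (addrI (f 0)); rewrite -fD !addr0.
have fZ (a : A^c) x : f (a *: x) = (f x : A) * a.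
  by have := lf a x 0; rewrite !addr0 f0 addr0.
pose ft z : A := f (xget 0 [set y | res_d P 0 y = z]).
have ftE y : ft (res_d P 0 y) = f y.
  rewrite /ft; case: xgetP => [y' _ yy'|/(_ y)[]//].
  have [z zE] : exists z, res_d P 1 z = y' - y.
    have dB : res_d P 0 (y' - y) = res_d P 0 y' - res_d P 0 y by exact: raddfB.
    by apply/res_exactS; rewrite dB yy' subrr.
  by rewrite -[y'](subrK y) -zE fD fd add0r.
have ftD z w : res_eps P z = 0 -> res_eps P w = 0 -> ft (z + w) = ft z + ft w.
  by move=> /res_exact0[y <-] /res_exact0[y' <-]; rewrite -raddfD !ftE fD.
have ftZ (a : A^c) z : res_eps P z = 0 -> ft (a *: z) = ft z * a.
  by move=> /res_exact0[y <-]; rewrite -linearZ !ftE fZ.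
have Ieps x : I x -> res_eps P (alpha x) = 0.
  by move=> Ix; rewrite alphaE; apply/quot_class_eq0.
pose phi x : A := ft (alpha x).
have phiD x y : I x -> I y -> phi (x + y) = phi x + phi y.
  by move=> Ix Iy; rewrite /phi alphaD ftD ?Ieps.
have phiM x a : I x -> phi (x * iA a) = phi x * a.
  by move=> Ix; rewrite /phi alphaZ ftZ ?Ieps.
have [|x y Ix|b bE] := inner (frobenius_lift L phi).
- move=> x y Ix Iy; apply: (frobenius_liftD L (J := I)) => // *; exact: trace_idealMr.
- apply: (frobenius_liftM S2 integral_l integral_norm (J := I)) => // *.
  + exact: trace_idealD.
  + exact: trace_ideal0.
  + exact: trace_idealMr.
have phiE x : I x -> phi x = tau (b * x).
  move=> Ix; rewrite -bE //; symmetry.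
  apply: (smash_form_lift S2 integral_l integral_norm (J := I)) => // *.
  exact: trace_idealMr.
(* For p = d y, beta(p) lies in I and the first term is ft(alpha(beta(p))), so the sum is ft(p) =
   f(y). *)
exists (fun p => tau (b * beta p) + ft (p - alpha (beta p)) : A^c^o).
  move=> a p q; rewrite betaD betaZ alphaD alphaZ mulrDr mulrA tauD tauMr opprD.
  rewrite addrACA -scalerBr ftD ?ftZ ?alpha_beta //; last first.
    by rewrite [LHS]linearZ alpha_beta; exact: scaler0.
  by rewrite addrACA -[X in X + _]mulrDl.
move=> y; have Iy := beta_d y.
rewrite -(phiE _ Iy) /phi -(ftD _ _ (Ieps _ Iy) (alpha_beta _)) -ftE.
by rewrite addrC subrK.
Qed.

End TraceQuotientExt.

(** * Growth *)

Section Growth.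
Variable R : realType.
Local Open Scope ereal_scope.

Lemma growth_rate_ltP (f : nat -> \bar R) (c : R) : growth_rate f < c%:E ->
  exists N, forall n, (N <= n)%N -> elog n (f n) <= c%:E.
Proof.
move=> /ereal_inf_lt[_ [V [N _ NV] <-] supV]; exists N => n Nn.
apply: le_trans (ltW supV); apply: ereal_sup_ubound; exists n => //.
by apply: NV.
Qed.

Lemma growth_rate_le_ub (f : nat -> \bar R) (x : \bar R) N :
  (forall n, (N <= n)%N -> elog n (f n) <= x) -> growth_rate f <= x.
Proof.
move=> fx; apply: ereal_inf_le; exists (ereal_sup ((fun n => elog n (f n)) @` [set n | (N <= n)%N])).
  by exists [set n | (N <= n)%N] => //; exists N.
by apply: ub_ereal_sup => _ [n Nn <-]; exact: fx.
Qed.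

(** The factor r and the shift k change the logarithm by a bounded amount, because n + k <= n (k +
    1); after division by ln n this tends to 0. *)
Lemma growth_rate_le (f g : nat -> \bar R) (r k : nat) : (0 < r)%N ->
  (forall n, f n <= (r%:R)%:E * g (n + k)%N) ->
  growth_rate f <= growth_rate g.
Proof.
move=> r_gt0 fg.
suff step (c : R) : growth_rate g < c%:E -> growth_rate f <= c%:E.
  case: (growth_rate g) step => [x| |] step.
  - apply/lee_addgt0Pr => ep ep0; rewrite -EFinD; apply: step.
    by rewrite lte_fin ltrDl.
  - exact: leey.
  - case: (growth_rate f) step => [y||//] step.
      have := step (y - 1)%R (ltNyr _).
      by rewrite lee_fin lerBrDr gerDl ler10.
    by have := step 0%R (ltNyr _); rewrite leye_eq.
move=> /growth_rate_ltP[N gN].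
apply/lee_addgt0Pr => ep ep0.
(* The absolute value serves c >= 0; for c < 0 the shift already helps and the term is merely
   nonnegative. *)
pose C : R := (ln r%:R + `|c| * ln k.+1%:R)%R.
have C0 : (0 <= C)%R.
  by rewrite addr_ge0 ?mulr_ge0 ?ln_ge0 // ler1n.
have [N2 N2P] : exists N2 : nat, forall n, (N2 <= n)%N -> (C <= ep * ln n%:R)%R.
  exists (Num.bound (expR (C / ep))) => n Nn.
  rewrite -ler_pdivrMl // mulrC -ler_expR lnK; last first.
    rewrite posrE ltr0n; apply: leq_trans Nn.
    by rewrite -(ltr0n R); apply: le_lt_trans (archi_boundP (expR_ge0 _)); exact: expR_ge0.
  apply: ltW; apply: lt_le_trans (archi_boundP (expR_ge0 _)) _.
  by rewrite ler_nat.
(* From n = 2 on ln n > 0, so [elog] is an honest quotient. *)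
apply: (@growth_rate_le_ub _ _ (maxn (maxn N 2) N2)) => n.
rewrite !geq_max => /andP[/andP[Nn n2] N2n].
have ln0 : (0 < ln n%:R :> R)%R by rewrite ln_gt0 // ltr1n.
have lnk : (ln (n + k)%:R <= ln n%:R + ln k.+1%:R :> R)%R.
  have n0 : (0 < n)%N by exact: ltn_trans n2.
  rewrite -lnM ?posrE ?ltr0n // ler_ln ?posrE ?mulr_gt0 ?ltr0n ?addn_gt0 ?n0 //.
  by rewrite -natrM ler_nat mulnS leq_add2l leq_pmull.
have lnk0 : (ln n%:R <= ln (n + k)%:R :> R)%R.
  have n0 : (0 < n)%N by exact: ltn_trans n2.
  by rewrite ler_ln ?posrE ?ltr0n ?addn_gt0 ?n0 // ler_nat leq_addr.
have lnf : lne (f n) <= (C + c * ln n%:R)%:E.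
  have := gN (n + k)%N (leq_trans Nn (leq_addr _ _)).
  have ln0k : (0 < ln (n + k)%:R :> R)%R := lt_le_trans ln0 lnk0.
  rewrite /elog lee_pdivrMr // -EFinM => lng.
  have [f0|f0] := leP (f n) 0; first by rewrite le0_lneNy // leNye.
  have r0 : (0 < r%:R :> R)%R by rewrite ltr0n.
  move: lng (fg n); case: (g (n + k)%N) => [y| |].
  - have [y0|y0] := leP y 0%R.
      move=> _ fle; have := lt_le_trans f0 fle.
      by rewrite -EFinM lte_fin pmulr_rgt0 // ltNge y0.
    rewrite lne_EFin // lee_fin => lng; rewrite -EFinM => fle.
    have fin_f : f n = (fine (f n))%:E.
      rewrite fineK // fin_numE gt_eqF ?lt_eqF //.
        by apply: le_lt_trans fle _; exact: ltry.
      by apply: lt_trans f0; exact: ltNy0.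
    rewrite fin_f in f0 fle *; rewrite lte_fin in f0; rewrite lee_fin in fle.
    rewrite lne_EFin // lee_fin.
    apply: (@le_trans _ _ (ln (r%:R * y))%R); first by rewrite ler_ln ?posrE ?mulr_gt0.
    rewrite lnM ?posrE // /C -addrA lerD2l; apply: le_trans lng _.
    have [c0|c0] := leP 0%R c.
      by rewrite (ger0_norm c0) -mulrDr ler_wpM2l // addrC.
    apply: (@le_trans _ _ (c * ln n%:R)%R); first by rewrite ler_wnM2l // ltW.
    by rewrite lerDr mulr_ge0 ?ln_ge0 // ler1n.
  - by rewrite /= leye_eq.
  - by move=> _; rewrite mulrNy gtr0_sg // mul1e leNgt (lt_trans _ f0) ?ltNy0.
rewrite /elog lee_pdivrMr // -EFinD -EFinM.
apply: le_trans lnf _; rewrite lee_fin mulrDl addrC lerD2l.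
exact: N2P.
Qed.

End Growth.

(** * Linear algebra modulo a subspace *)

Section DimensionModulo.
Variable K : fieldType.
Implicit Types V : lmodType K.

Lemma subspaceD V (W : set V) u v : subspace W -> W u -> W v -> W (u + v).
Proof. by move=> [_ WP] Wu Wv; rewrite -[u]scale1r; exact: WP. Qed.
Lemma subspaceZ V (W : set V) c u : subspace W -> W u -> W (c *: u).
Proof. by move=> [W0 WP] Wu; rewrite -[_ *: _]addr0; exact: WP. Qed.
Lemma subspace_sum V (W : set V) (I : Type) (s : seq I) (P : pred I) (F : I -> V) :
  subspace W -> (forall i, P i -> W (F i)) -> W (\sum_(i <- s | P i) F i).
Proof.
by move=> sW WF; elim/big_ind: _ => // [|u v]; [exact: sW.1|exact: subspaceD].
Qed.

(** As an intersection of subspaces, the span needs no coefficients, and applying a membership proof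
    to a subspace is induction on the span. *)
Definition linear_span V (S : set V) : set V :=
  [set x | forall W, subspace W -> S `<=` W -> W x].

Lemma linear_span_sub V (S : set V) : subspace (linear_span S).
Proof.
split=> [W sW _|c u v Su Sv W sW SW]; first exact: sW.1.
by apply: sW.2; [exact: Su|exact: Sv].
Qed.

Lemma linear_span_gen V (S : set V) : S `<=` linear_span S.
Proof. by move=> x Sx W _; apply. Qed.

Lemma linear_span_seq V (s : seq V) x : linear_span [set v | v \in s] x ->
  exists c : nat -> K, x = \sum_(i < size s) c i *: s`_i.
Proof.
move=> /(_ [set x | exists c : nat -> K, x = \sum_(i < size s) c i *: s`_i]).
apply=> [|v /= vs].
  split=> [|a u v [b ->] [c ->]].
    by exists (fun=> 0); rewrite big1 // => i _; rewrite scale0r.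
  exists (fun i => a * b i + c i); rewrite scaler_sumr -big_split.
  by apply: eq_bigr => i _; rewrite scalerDl scalerA.
have vi : (index v s < size s)%N by rewrite index_mem.
exists (fun i => (i == index v s)%:R).
rewrite (bigD1 (Ordinal vi)) //= eqxx scale1r nth_index // big1 ?addr0 // => i.
by rewrite -val_eqE /= => /negPf ->; rewrite scale0r.
Qed.

(** Steinitz exchange: if s were longer than w, the matrix expressing s by w modulo I would have a
    nonzero row in its left kernel, a relation among s modulo I. *)
Lemma free_mod_size V (I : set V) (s w : seq V) : subspace I -> free_mod I s ->
  (forall v, v \in s -> exists2 u, linear_span [set x | x \in w] u & I (v - u)) ->
  (size s <= size w)%N.
Proof.
move=> sI frs sw.
have coeffs (i : 'I_(size s)) : exists c : nat -> K,
    I (s`_i - \sum_(j < size w) c j *: w`_j).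
  have [u /linear_span_seq[c ->] Iu] := sw _ (mem_nth 0 (ltn_ord i)).
  by exists c.
have [c cP] := choice coeffs.
pose C : 'M[K]_(size s, size w) := \matrix_(i, j) c i j.
rewrite leqNgt; apply/negP => lt_ws.
have : kermx C != 0.
  by rewrite kermx_eq0 -row_leq_rank -ltnNge (leq_ltn_trans (rank_leq_col C)).
case/rowV0Pn => r /sub_kermxP rC /negP[]; apply/eqP/rowP => i; rewrite mxE.
pose a (k : nat) : K := oapp (fun k => r 0 k) 0 (insub k).
have aE (k : 'I_(size s)) : a k = r 0 k by rewrite /a valK.
rewrite -aE; apply: frs => //.
have -> : \sum_(i < size s) a i *: s`_i =
    \sum_(i < size s) a i *: (s`_i - \sum_(j < size w) c i j *: w`_j).
  apply/eqP; rewrite -subr_eq0 -sumrB; apply/eqP.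
  transitivity (\sum_(j < size w) (r *m C) 0 j *: w`_j); last first.
    by rewrite rC big1 // => j _; rewrite mxE scale0r.
  transitivity (\sum_(i < size s) \sum_(j < size w) (a i * c i j) *: w`_j).
    apply: eq_bigr => k _; rewrite -scalerBr opprB addrC subrK scaler_sumr.
    by apply: eq_bigr => j _; rewrite scalerA.
  rewrite exchange_big; apply: eq_bigr => j _; rewrite mxE scaler_suml.
  by apply: eq_bigr => k _; rewrite aE mxE.
by apply: subspace_sum => // k _; exact: subspaceZ.
Qed.

Lemma free_mod_rcons V (I : set V) (s : seq V) v : subspace I -> free_mod I s ->
  ~ free_mod I (rcons s v) ->
  exists2 u, linear_span [set x | x \in s] u & I (v - u).
Proof.
move=> sI frs nfr; apply: contra_notP nfr => nu c.
rewrite size_rcons big_ord_recr /= nth_rcons ltnn eqxx.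
under eq_bigr => i _ do rewrite nth_rcons ltn_ord.
move=> Ic.
have cs : c (size s) = 0.
  apply: contra_notP nu => /eqP c_neq0.
  exists (- (c (size s))^-1 *: \sum_(i < size s) c i *: s`_i).
    have sps := @linear_span_sub V [set x | x \in s].
    apply: (subspaceZ _ sps); apply: (subspace_sum _ sps) => i _.
    apply: (subspaceZ _ sps).
    by apply: linear_span_gen; rewrite /= mem_nth.
  rewrite scaleNr opprK; have := subspaceZ (c (size s))^-1 sI Ic.
  by rewrite scalerDr scalerA mulVf // scale1r addrC.
move: Ic; rewrite cs scale0r addr0 => /frs ci i.
by rewrite ltnS leq_eqVlt => /orP[/eqP ->|/ci].
Qed.

Section Bounds.
Variable R : realType.
Local Open Scope ereal_scope.

Lemma dim_mod_ub V (I S : set V) (x : \bar R) :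
  (forall s : seq V, (forall v, v \in s -> S v) -> free_mod I s ->
     ((size s)%:R)%:E <= x) -> dim_mod R I S <= x.
Proof. by move=> sx; apply: ub_ereal_sup => _ [s [sS frs] <-]; exact: sx. Qed.

Lemma dim_mod_ge V (I S : set V) (s : seq V) :
  (forall v, v \in s -> S v) -> free_mod I s ->
  ((size s)%:R)%:E <= dim_mod R I S.
Proof. by move=> sS frs; apply: ereal_sup_ubound; exists s. Qed.

Lemma dim_mod_basis V (I S : set V) : subspace I -> dim_mod R I S < +oo ->
  exists s : seq V, ((size s)%:R)%:E <= dim_mod R I S /\
    forall v, S v -> exists2 u, linear_span [set x | x \in s] u & I (v - u)%R.
Proof.
move=> sI dim_fin.
pose good k := `[< exists s : seq V,
  [/\ size s = k, forall v, v \in s -> S v & free_mod I s] >].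
have good0 : exists k, good k.
  by exists 0%N; apply/asboolP; exists [::]; split=> // c _ i.
have [D dimD] : exists D : nat, dim_mod R I S <= (D%:R)%:E.
  case: (dim_mod R I S) dim_fin => [x _|//|_]; last by exists 0%N; rewrite leNye.
  exists (Num.bound x); rewrite lee_fin.
  case: (leP 0%R x) => [x0|x0]; first exact/ltW/archi_boundP.
  exact: le_trans (ltW x0) (ler0n _ _).
have good_ub k : good k -> (k <= D)%N.
  move=> /asboolP[s [<- sS frs]]; rewrite -(ler_nat R) -lee_fin.
  exact: le_trans (dim_mod_ge sS frs) dimD.
have [k /asboolP[s [sk sS frs]] k_max] := ex_maxnP good0 good_ub.
exists s; split=> [|v Sv]; first exact: dim_mod_ge.
apply: free_mod_rcons => // frv.
have /k_max : good k.+1; last by rewrite ltnn.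
apply/asboolP; exists (rcons s v); split=> //; first by rewrite size_rcons sk.
by move=> x; rewrite mem_rcons inE => /orP[/eqP ->//|/sS].
Qed.

(** The images under all L_j of a maximal free family of S' span S modulo I. *)
Lemma dim_mod_le V V' (J : finType) (j0 : J) (L : J -> V' -> V)
    (I S : set V) (I' S' : set V') : subspace I -> subspace I' ->
  (forall j, linear (L j)) -> (forall j x, I' x -> I (L j x)) ->
  S `<=` linear_span [set L z.1 z.2 | z in [set z : J * V' | S' z.2]] ->
  dim_mod R I S <= (#|J|%:R)%:E * dim_mod R I' S'.
Proof.
move=> sI sI' lL LI SL.
have J0 : (0 < #|J|)%N by apply/card_gt0P; exists j0.
have [dim_oo|dim_fin] := eqVneq (dim_mod R I' S') +oo.
  by rewrite dim_oo mulry gtr0_sg ?ltr0n // mul1e leey.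
rewrite -ltey in dim_fin.
have [s' [s'_dim s'P]] := dim_mod_basis sI' dim_fin.
pose w := [seq L j v | j <- enum J, v <- s'].
have sw : size w = (#|J| * size s')%N by rewrite size_allpairs -cardE.
pose W := [set v | exists2 u, linear_span [set x | x \in w] u & I (v - u)%R].
have spw := @linear_span_sub V [set x | x \in w].
have sW : subspace W.
  split=> [|c v v' [u wu Iu] [u' wu' Iu']].
    by exists 0%R; [exact: spw.1|rewrite subr0; exact: sI.1].
  exists (c *: u + u')%R; first exact: spw.2.
  by rewrite opprD addrACA -scalerBr; exact: sI.2.
have SW : S `<=` W.
  move=> v Sv; apply: (SL v Sv) => //; move=> _ [[j x] /= Sx <-].
  have [u /linear_span_seq[c ->] Iu] := s'P _ Sx.
  exists (L j (\sum_(i < size s') c i *: s'`_i))%R; last first.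
    by rewrite -scaleN1r -(linZ (lL j)) -(linD (lL j)) scaleN1r; exact: LI.
  rewrite (lin_sum (lL j)); apply: (subspace_sum _ spw) => i _.
  rewrite (linZ (lL j)); apply: (subspaceZ _ spw); apply: linear_span_gen => /=.
  by apply: allpairs_f; rewrite ?mem_enum ?mem_nth.
apply: dim_mod_ub => s sS frs.
have : (size s <= size w)%N by apply: (free_mod_size sI frs) => v /sS /SW.
rewrite sw => le_sw.
apply: (@le_trans _ _ (((#|J| * size s')%N)%:R)%:E); first by rewrite lee_fin ler_nat.
by rewrite natrM EFinM lee_wpmul2l // lee_fin.
Qed.

End Bounds.
End DimensionModulo.

Lemma prod_converse (K : fieldType) (A : algType K) (w : seq A) :
  \prod_(y <- w) (y : A^c) = \prod_(y <- rev w) y.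
Proof.
elim: w => [|y w IH]; first by rewrite !big_nil.
by rewrite rev_cons big_rcons big_cons IH.
Qed.

Lemma GKdim_converse (R : realType) (K : fieldType) (A : algType K) :
  GKdim R A^c = GKdim R A.
Proof.
rewrite /GKdim /GKdim_subquotient; congr (ereal_sup [set growth_rate _ | _ in _]).
apply: funext => g; apply: funext => n; congr (dim_mod _ _ _).
apply/seteqP; split=> x /= [w [sw wg ->]]; exists (rev w).
  rewrite size_rev; split=> // [y|]; first by rewrite mem_rev; exact: wg.
  by rewrite prod_converse.
rewrite size_rev; split=> // [y|]; first by rewrite mem_rev; exact: wg.
by rewrite prod_converse revK.
Qed.

(** * The algebra Lambda/<e_0> and the module B/I grow alike *)

Section LambdaGrowth.
Variables (R : realType) (K : fieldType) (H : falgType K) (Hs : hopf_structure H).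
Variables (A : algType K) (G : connected_grading A) (M : hopf_action Hs G).
Local Notation B := (smash M).
Local Notation iA := (smashA M).
Local Notation iH := (smashH M).
Local Notation S := (antipode Hs).
Local Notation eps := (counit Hs).
Local Notation tau := (@smash_form K H Hs A G M).
Let lA := smashA_linear M.
Let lH := smashH_linear M.
Hypothesis S2 : forall h, S (S h) = h.
Variables (n : nat) (e : 'I_n.+1 -> H).
Hypothesis eP : basic_idempotents Hs e.
Local Notation L := (e ord0).
Local Notation I := (@trace_ideal K H Hs A G M L).
Local Notation N := (trace_quotient M L).
Local Notation cl := (quot_class (trace_submod M L)).
Local Notation E := (iH (\sum_i e i)).
Let integral_l := basic_idempotent_integral eP.
Let integral_norm := basic_idempotent_counit eP.

Let b (i : 'I_(\dim {:H})) : H := (vbasis {:H})`_i.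

Lemma trace_ideal_subspace : subspace I.
Proof.
split=> [|c u v Iu Iv]; first exact: trace_ideal0.
by apply: trace_idealD => //; rewrite -mulr_algl; exact: trace_idealMl.
Qed.

Let clZ (c : K) (u : B) : (cl (c *: u) : restrict_scalars N) = c *: (cl u : restrict_scalars N).
Proof.
transitivity (cl (((c%:A : A) : A^c) *: (u : smash_right M))); last exact: linearZ.
by congr cl; rewrite smash_right_scaleE (linZ lA) smashA1 -scalerAr mulr1.
Qed.

Let cl_linear : linear (cl : B -> restrict_scalars N).
Proof.
move=> c u v; rewrite -clZ; exact: quot_classD.
Qed.

Let idemE : E * E = E.
Proof.
rewrite -smashHM; congr iH; rewrite mulr_suml; apply: eq_bigr => i _.
rewrite mulr_sumr (bigD1 i) //= (basic_idempotent_idem eP) big1 ?addr0 // => j ji.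
by rewrite eP.1 eq_sym (negPf ji).
Qed.

Let EL : E * iH L = iH L.
Proof.
rewrite -smashHM mulr_suml (bigD1 ord0) //= (basic_idempotent_idem eP).
by rewrite big1 ?addr0 // => j ji; rewrite eP.1 (negPf ji).
Qed.

Let LE : iH L * E = iH L.
Proof.
rewrite -smashHM mulr_sumr (bigD1 ord0) //= (basic_idempotent_idem eP).
by rewrite big1 ?addr0 // => j ji; rewrite eP.1 eq_sym (negPf ji).
Qed.

Let LambdaP x : Lambda M e x <-> E * x * E = x.
Proof.
split=> [[y ->]|Ex]; last by exists x.
by rewrite !mulrA idemE -mulrA idemE.
Qed.

(** As E e_0 = e_0 = e_0 E, cutting a sum of products x e_0 y by E on both sides puts its factors in
    Lambda. So Lambda/<e_0> embeds in B/I. *)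
Let Lambda_e0P x : Lambda_e0 M e x <-> Lambda M e x /\ I x.
Proof.
split=> [[s [sP ->]]|[/LambdaP Ex [s sE]]].
  split.
    apply/LambdaP; rewrite mulr_sumr mulr_suml; apply: eq_big_seq => y /sP[+ _ +].
    move=> /LambdaP y1 /LambdaP y2; rewrite -{1}y1 -{1}y2.
    by rewrite -[in RHS]y1 -[in RHS]y2 !mulrA idemE -!mulrA idemE.
  rewrite big_seq; elim/big_ind: _ => [|u v|y /sP[_ -> _]].
  - exact: trace_ideal0.
  - exact: trace_idealD.
  - exact: trace_ideal_gen.
exists [seq (E * y.1 * E, iH L, E * y.2 * E) | y <- s]; split.
  move=> _ /mapP[y _ ->] /=; split=> //; first by exists y.1.
  by exists y.2.
rewrite big_map /= -Ex sE mulr_sumr mulr_suml; apply: eq_bigr => y _.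
by rewrite -[iH L in LHS]LE -{1}EL !mulrA.
Qed.

Lemma Lambda_subspace : subspace (Lambda M e).
Proof.
split=> [|c u v /LambdaP Eu /LambdaP Ev]; apply/LambdaP.
  by rewrite mulr0 mul0r.
by rewrite mulrDr mulrDl -scalerAr -scalerAl Eu Ev.
Qed.

Lemma Lambda_e0_subspace : subspace (Lambda_e0 M e).
Proof.
have sL := Lambda_subspace; have sI := trace_ideal_subspace.
split=> [|c u v /Lambda_e0P[Lu Iu] /Lambda_e0P[Lv Iv]]; apply/Lambda_e0P.
  by split; [exact: sL.1|exact: sI.1].
by split; [exact: sL.2|exact: sI.2].
Qed.

Lemma Lambda_dim_mod (X : set B) : X `<=` Lambda M e ->
  (dim_mod R (Lambda_e0 M e) X <= dim_mod R I X)%E.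
Proof.
move=> XL; apply: dim_mod_ub => s sX frs; apply: dim_mod_ge => // c Ic.
apply: frs; apply/Lambda_e0P; split=> //.
apply: (subspace_sum _ Lambda_subspace) => i _.
by apply: (subspaceZ _ Lambda_subspace); apply: XL; apply: sX; rewrite mem_nth.
Qed.

Lemma quotient_dim_mod (X : set B) :
  (dim_mod R I X <= @dim_mod K (restrict_scalars N) R [set 0%R] (cl @` X))%E.
Proof.
apply: dim_mod_ub => s sX frs; rewrite -(size_map (cl : B -> restrict_scalars N)).
apply: dim_mod_ge => [_ /mapP[v vs ->]|c]; first by exists v => //; exact: sX.
rewrite size_map /= => c0; apply: frs; apply/(quot_class_eq0 (trace_submod M L)).
rewrite -[RHS]c0 [LHS](lin_sum cl_linear).
by apply: eq_bigr => i _; rewrite (nth_map 0) // clZ.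
Qed.

Section UpperBound.
Variable g : seq B.

(* The coefficients of g, translated by a basis of H so as to span an H-stable
   subspace of A. *)
Let gen : seq A :=
  [seq M (b z.1) (tau (iH (b z.2) * y)) | y <- g, z <- enum {: 'I_(\dim {:H}) * 'I_(\dim {:H})}].

(** A normal form with the H-part first: its class in N is a product of letters of A acting from the
    right on the class of a basis vector of H. *)
Let words k : set B :=
  [set x | exists j, exists u : seq A,
     [/\ size u = k, {subset u <= gen} & x = iH (b j) * iA (\prod_(a <- u) a)]].

Let words_H k h u : size u = k -> {subset u <= gen} ->
  linear_span (words k) (iH h * iA (\prod_(a <- u) a)).
Proof.
move=> su ug; rewrite (coord_vbasis (memvf h)) (lin_sum lH) mulr_suml.
have sp := linear_span_sub (words k).
apply: (subspace_sum _ sp) => i _; rewrite (linZ lH) -scalerAl.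
by apply: (subspaceZ _ sp); apply: linear_span_gen; exists i, u.
Qed.

(** Expand y by the dual basis as sum S(c_i) tau(b_i y), where Delta(L) = sum c_i (x) b_i, and move
    the H-prefix of x to the left past tau(b_i y). This twists tau(b_i y) by the action of H, whence
    the translates in [gen]; exactly one letter is added. *)
Let words_mul k y x : y \in g -> linear_span (words k) x ->
  linear_span (words k.+1) (y * x).
Proof.
move=> yg; have sp := linear_span_sub (words k.+1).
move=> /(_ [set x | linear_span (words k.+1) (y * x)]); apply.
  split=> [|c u v /= yu yv]; first by rewrite /= mulr0; exact: sp.1.
  by rewrite mulrDr -scalerAr; exact: sp.2.
move=> _ [j [u [su ug ->]]] /=.
rewrite -(smash_dual_basisr S2 integral_l integral_norm y) /tlift mulr_suml.
apply: (subspace_sum _ sp) => i _.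
rewrite -mulrA [iA _ * (_ * _)]mulrA -[b j]S2 -smash_antipode /tlift mulr_suml mulr_sumr.
apply: (subspace_sum _ sp) => l _.
rewrite -!mulrA -smashAM mulrA -smashHM.
set a := M _ _; have -> : a * \prod_(a <- u) a = \prod_(a <- a :: u) a by rewrite big_cons.
apply: words_H; first by rewrite /= su.
move=> c; rewrite inE => /orP[/eqP ->|/ug//].
by apply/allpairsP; exists (y, (l, i)); rewrite /= mem_enum.
Qed.

Let words_prod w : {subset w <= g} ->
  linear_span (words (size w)) (\prod_(y <- w) y).
Proof.
elim: w => [_|y w IH wg].
  have := @words_H 0 1 [::] erefl; rewrite !big_nil smashA1 mulr1 smashH1; exact.
rewrite big_cons; apply: words_mul; first by apply: wg; rewrite mem_head.
by apply: IH => z zw; apply: wg; rewrite inE zw orbT.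
Qed.

Lemma Lambda_growth_le : (forall y, y \in g -> Lambda M e y) ->
  (growth_rate (fun k => dim_mod R (Lambda_e0 M e)
      [set x : B | exists w : seq B,
         [/\ (0 < size w <= k)%N, {subset w <= g} & x = (\prod_(y <- w) y)%R]])
   <= GKdim_module R N)%E.
Proof.
move=> gL.
pose gm : seq A^c * seq N := (gen, [seq cl (iH (b j)) | j <- enum 'I_(\dim {:H})]).
apply: le_trans (ereal_sup_ubound _); last by exists gm.
apply: (@growth_rate_le _ _ _ 1 0) => // k; rewrite mul1e addn0.
apply: le_trans (Lambda_dim_mod _) _.
  (* The empty word is excluded because the unit of Lambda is E, not 1. *)
  move=> _ [[|y w] [//= _ wg ->]]; rewrite big_cons.
  elim: w y wg => [|z w IH] y wg.
    by rewrite big_nil mulr1; apply: gL; apply: wg; rewrite mem_head.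
  have /LambdaP Ly : Lambda M e y by apply: gL; apply: wg; rewrite mem_head.
  have /IH/LambdaP Lz : {subset z :: w <= g}.
    by move=> x xw; apply: wg; rewrite inE xw orbT.
  rewrite big_cons; apply/LambdaP; rewrite -{1}Ly -{1}Lz -[in RHS]Ly -[in RHS]Lz.
  by rewrite !mulrA idemE -!mulrA idemE.
pose X : set B := [set x | exists j, exists u : seq A,
  [/\ (size u <= k)%N, {subset u <= gen} & x = iH (b j) * iA (\prod_(a <- u) a)]].
have sI := trace_ideal_subspace.
apply: (@le_trans _ _ (dim_mod R I X)).
  rewrite -[leRHS]mul1e (_ : 1%E = (#|{: unit}|%:R)%:E); last by rewrite card_unit.
  apply: (@dim_mod_le _ _ _ _ _ tt (fun=> id)) => //.
  move=> _ [w [/andP[_ wk] wg ->]]; have := words_prod wg; apply; first exact: linear_span_sub.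
  move=> x [j [u [su ug ->]]]; apply: linear_span_gen.
  exists (tt, iH (b j) * iA (\prod_(a <- u) a)) => //=.
  by exists j, u; rewrite su.
apply: le_trans (quotient_dim_mod X) _.
apply: dim_mod_ub => s sX frs; apply: dim_mod_ge => // v /sX[_ [j [u [su ug ->]]] <-].
exists (rev u), (cl (iH (b j))); rewrite size_rev; split=> //.
- by move=> y; rewrite mem_rev; exact: ug.
- by apply/mapP; exists j; rewrite // mem_enum.
- by rewrite prod_converse revK -linearZ.
Qed.

End UpperBound.

Section LowerBound.
Variables (g : seq A^c) (m : seq N).

(** Inserting 1 = sum p_i E q_i around every letter of a word in B turns it into a sum of p_i v q_j,
    where v is a word of the same length in the elements E q_i x p_j E of Lambda. *)
Lemma module_growth_le :
  (growth_rate (fun k => @dim_mod K (restrict_scalars N) R [set 0%R]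
      [set x | exists (w : seq A^c) (z : N),
         [/\ (size w <= k)%N, {subset w <= g}, z \in m
           & x = ((\prod_(y <- w) y) *: z)%R]])
   <= GKdim_subquotient R (Lambda M e) (Lambda_e0 M e))%E.
Proof.
have [s s1] := basic_idempotents_full eP.
pose J := ('I_(size s) * 'I_(size s))%type.
have s_gt0 : (0 < size s)%N.
  rewrite lt0n size_eq0; apply/eqP => s0; move: s1; rewrite s0 big_nil => /eqP.
  by rewrite eq_sym oner_eq0.
pose j0 : J := (Ordinal s_gt0, Ordinal s_gt0).
pose p (i : 'I_(size s)) : B := iH (nth (0, 0) s i).1.
pose q (i : 'I_(size s)) : B := iH (nth (0, 0) s i).2.
have pq1 : \sum_i p i * E * q i = 1.
  rewrite -(smashH1 M) -s1 [RHS](lin_sum lH) (big_nth (0, 0)) big_mkord.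
  by apply: eq_bigr => i _; rewrite !smashHM.
have [lift liftE] := choice (fun z => quot_class_surj (z : N)).
pose Z : seq B := [seq iA a | a <- g] ++ [seq lift z | z <- m].
pose g' : seq B := [seq E * (q t.1 * x * p t.2) * E | x <- Z, t <- enum {: J}].
have g'L y : y \in g' -> Lambda M e y.
  by move=> /allpairsP[[x t] [_ _ ->]]; exists (q t.1 * x * p t.2).
apply: le_trans (ereal_sup_ubound _); last by exists g'.
(* The factor counts the outer pairs (p_i, q_j); the shift by 1 is for the letter that lifts the
   module generator. *)
apply: (@growth_rate_le _ _ _ #|{: J}| 1).
  by apply/card_gt0P; exists j0.
move=> k; pose W k := [set x : B | exists w : seq B,
  [/\ size w = k, {subset w <= g'} & x = \prod_(y <- w) y]].
pose T k := [set x : B | exists t : J, exists2 y, W k y & x = p t.1 * y * q t.2].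
have gen_mem x i j : x \in Z -> E * (q i * x * p j) * E \in g'.
  by move=> xZ; apply/allpairsP; exists (x, (i, j)); rewrite /= mem_enum.
have T1 x : x \in Z -> linear_span (T 1) x.
  move=> xZ; have sp := linear_span_sub (T 1).
  rewrite -[x]mulr1 -[x * 1]mul1r -pq1 mulr_suml; apply: (subspace_sum _ sp) => i _.
  rewrite !mulr_sumr; apply: (subspace_sum _ sp) => j _.
  apply: linear_span_gen; exists (i, j); exists (E * (q i * x * p j) * E).
    exists [:: E * (q i * x * p j) * E]; rewrite big_seq1; split=> // y.
    by rewrite inE => /eqP ->; exact: gen_mem.
  by rewrite !mulrA.
have TS l x y : x \in Z -> linear_span (T l.+1) y -> linear_span (T l.+2) (x * y).
  move=> xZ; have sp := linear_span_sub (T l.+2).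
  move=> /(_ [set y | linear_span (T l.+2) (x * y)]); apply.
    split=> [|c u v /= xu xv]; first by rewrite /= mulr0; exact: sp.1.
    by rewrite mulrDr -scalerAr; exact: sp.2.
  move=> _ [[i j] [_ [[|z w] [//= [sw] wg' ->]] ->]] /=.
  rewrite -[x * _]mul1r -{1}pq1 mulr_suml; apply: (subspace_sum _ sp) => r _.
  apply: linear_span_gen; exists (r, j).
  exists (\prod_(y <- E * (q r * x * p i) * E :: z :: w) y).
    exists (E * (q r * x * p i) * E :: z :: w); rewrite /= sw; split=> // y'.
    by rewrite inE => /orP[/eqP ->|/wg'//]; exact: gen_mem.
  (* The first old letter satisfies z = E z E and supplies the E that closes the new letter; this is
     why the old word must be nonempty. *)
  have /g'L/LambdaP zE : z \in g' by apply: wg'; rewrite mem_head.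
  rewrite !big_cons -{1}zE -[in RHS]zE; set P := \prod_(_ <- _) _.
  by rewrite !mulrA -(mulrA _ E E) idemE.
have Tprod x w : {subset x :: w <= Z} -> linear_span (T (size w).+1) (\prod_(y <- x :: w) y).
  elim: w x => [|y w IH] x xwZ.
    by rewrite big_seq1; apply: T1; apply: xwZ; rewrite mem_head.
  rewrite big_cons; apply: TS; first by apply: xwZ; rewrite mem_head.
  by apply: IH => v vw; apply: xwZ; rewrite inE vw orbT.
have sL := Lambda_e0_subspace.
have s0 : subspace [set (0 : restrict_scalars N)].
  by split=> // c u v /= -> ->; rewrite scaler0 addr0.
apply: (@dim_mod_le _ _ _ _ _ j0 (fun t y => cl (p t.1 * y * q t.2) : restrict_scalars N)) => //.
- move=> t c u v; rewrite -cl_linear; congr cl.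
  by rewrite mulrDr mulrDl -scalerAr -scalerAl.
- move=> t y /Lambda_e0P[_ Iy]; apply/(quot_class_eq0 (trace_submod M L)).
  by apply: trace_idealMr; exact: trace_idealMl.
move=> _ [w [z [wk wg zm ->]]].
have -> : (\prod_(y <- w) y) *: z =
    cl (\prod_(y <- lift z :: [seq iA a | a <- rev w]) y).
  rewrite prod_converse -{1}[z]liftE -linearZ smash_right_scaleE big_cons big_map.
  by congr (cl (_ * _)); apply: (big_morph iA (@smashAM _ _ _ _ _ M) (smashA1 M)).
set X : set (restrict_scalars N) := [set _ | _ in _].
have spX := linear_span_sub X.
have : linear_span (T (size w).+1) (\prod_(y <- lift z :: [seq iA a | a <- rev w]) y).
  have -> : size w = size [seq iA a | a <- rev w] by rewrite size_map size_rev.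
  apply: Tprod => y; rewrite inE mem_cat => /orP[/eqP ->|/mapP[a aw ->]].
    by apply/orP; right; exact: map_f.
  by apply/orP; left; apply: map_f; apply: wg; rewrite -mem_rev.
move=> /(_ [set y | linear_span X (cl y : restrict_scalars N)]); apply.
  split=> [|c u v /= Xu Xv].
    by rewrite /= (lin0 cl_linear); exact: spX.1.
  by rewrite cl_linear; exact: spX.2.
move=> _ [t [y [v [sv vg' ->]] ->]]; apply: linear_span_gen => /=.
exists (t, \prod_(y <- v) y) => //=; exists v; split=> //.
by rewrite sv addn1.
Qed.

End LowerBound.

Lemma trace_quotient_GKdim :
  GKdim_module R N = GKdim_subquotient R (Lambda M e) (Lambda_e0 M e).
Proof.
apply/eqP; rewrite eq_le; apply/andP; split; apply: ub_ereal_sup.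
  by move=> _ [[g m] _ <-]; exact: module_growth_le.
by move=> _ [g gL <-]; exact: Lambda_growth_le.
Qed.

Lemma trace_quotient_fg : finitely_generated N.
Proof.
exists [seq cl (iH (S (coprod Hs L i))) | i <- enum 'I_(\dim {:H})] => x.
have [y <-] := quot_class_surj x.
exists (fun i => (tau (iH (vbasis {:H})`_i * y) : A^c)).
rewrite -(big_mkord xpredT (fun i => (tau (iH (vbasis {:H})`_i * y) : A^c) *:
  [seq cl (iH (S (coprod Hs L i))) | i <- enum 'I_(\dim {:H})]`_i)).
rewrite size_map size_enum_ord big_mkord -{1}(smash_dual_basisr S2 integral_l integral_norm y).
rewrite [LHS]raddf_sum; apply: eq_bigr => i _.
by rewrite (nth_map i) ?size_enum_ord // nth_ord_enum -linearZ.
Qed.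

End LambdaGrowth.

Lemma GKdim_module_zero (R : realType) (K : fieldType) (B : algType K)
    (M : lmodType B) : (forall x : M, x = 0) -> GKdim_module R M = -oo%E.
Proof.
move=> M0; apply/eqP; rewrite -leeNy_eq; apply: ub_ereal_sup => _ [gm _ <-].
apply: (@growth_rate_le_ub _ _ _ 2) => k k2.
have lnk : (0 < (ln k%:R : R)^-1) by rewrite invr_gt0 ln_gt0 // ltr1n.
rewrite /elog le0_lneNy; first by rewrite mulNyr gtr0_sg // mul1e.
apply: dim_mod_ub => -[|v s] // _ frs; have := frs (fun=> 1) (M0 _) 0%N isT.
by move/eqP; rewrite oner_eq0.
Qed.

Theorem theorem1p4 (R : realType) (K : closedFieldType)
    (charK : [pchar K] =i pred0)
    (A : algType K) (G : connected_grading A) (m d : nat) (ell : int)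
    (A_AS : AS_regular R G d ell)
    (A_Koszul : m_Koszul G m)
    (A_GKdim : GKdim R A = (d%:R)%:E)
    (A_CM : GK_CohenMacaulay R A)
    (H : falgType K) (Hs : hopf_structure H)
    (H_ss : semisimple_algebra H)
    (H_S2 : forall h, antipode Hs (antipode Hs h) = h)
    (M : hopf_action Hs G)
    (M_faithful : inner_faithful M)
    (hdet : H -> K) (hdetP : is_hdet M d hdet)
    (n : nat) (e : 'I_n.+1 -> H)
    (eP : basic_idempotents Hs e)
    (e_Xi : forall i, exists j, Xi Hs hdet (e i) = e j) :
  auslander_iso M <->
  (GKdim_subquotient R (Lambda M e) (Lambda_e0 M e) <= GKdim R A - 2%:E)%E.
Proof.
have int_l := basic_idempotent_integral eP.
have int_norm := basic_idempotent_counit eP.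
rewrite (auslander_isoE M int_l int_norm (basic_idempotent_idem eP ord0)).
rewrite -(trace_quotient_GKdim R M H_S2 eP) A_GKdim.
(* The Cohen-Macaulay property speaks of nonzero modules only. If B/I = 0, both sides hold: I
   contains 1, and the dimension of the zero module is -oo. *)
have [[x x_neq0]|N0] := pselect (exists x : trace_quotient M (e ord0), x != 0); last first.
  have Itrue (y : smash M) : trace_ideal (M := M) (e ord0) y.
    apply/(quot_class_eq0 (trace_submod M (e ord0))).
    by apply/eqP; apply: contra_notT N0 => y0; exists (quot_class (trace_submod M (e ord0)) y).
  split=> [_|_]; last first.
    split=> [b bI|f fD fM]; first by rewrite -[b]mulr1 bI.
    by exists (f 1) => y _; rewrite -fM // mul1r.
  rewrite GKdim_module_zero ?leNye // => y; apply/eqP.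
  by apply: contra_notT N0 => y0; exists y.
have [_ /(_ _ (trace_quotient_fg M H_S2 eP))] := A_CM.
case; first by exists x.
move=> j [j_neq j_lt]; rewrite GKdim_converse A_GKdim => j_dim.
have [_ _ [_ gldimc] _] := A_AS.
(* The equation j + GKdim N = d with d finite forces GKdim N to be finite. *)
have -> : (GKdim_module R (trace_quotient M (e ord0)) <= (d%:R)%:E - 2%:E)%E = (2 <= j)%N.
  move: j_dim; case: (GKdim_module R (trace_quotient M (e ord0))) => [g| |] //= -[jg].
  rewrite lee_fin -jg -(ler_nat R) addrAC lerDr subr_ge0 //.
split=> [[faith inner]|j2].
  (* [Ext_zero] asks for a resolution to be exhibited; finite global dimension supplies one. It
     remains to refute j = 0 and j = 1. *)
  have [P _] := gldimc.1 (trace_quotient M (e ord0)).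
  case: j j_neq {j_lt j_dim} => [|[|//]] [].
    exists P; exact: (ideal_faithful_vanishing H_S2 int_l int_norm).
  exists P; exact: (ideal_hom_inner_vanishing H_S2 int_l int_norm).
have [P0 van0] := j_lt 0%N (ltn_trans (ltn0Sn _) j2); have [P1 van1] := j_lt 1%N j2.
split.
  exact: (vanishing_ideal_faithful H_S2 int_l int_norm van0).
exact: (vanishing_ideal_hom_inner H_S2 int_l int_norm van1).
Qed.
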